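(* Let $G$ be a finite group and $\mathcal U$ a complete $G$-universe. Suppose that $X$ is an $\mathcal I$-cofibrant $G$-space. Then there is an isovariant map $X\to\mathcal U$, unique up to isovariant homotopy.
   Context: $G$ is a finite group; all spaces are compactly generated. A $G$-space is a space with a continuous left $G$-action; $G_x$ is the isotropy group of $x$. An isovariant map $f: X\to Y$ of $G$-spaces is a continuous equivariant map with $G_x=G_{f(x)}$ for all $x$. An isovariant homotopy between isovariant maps $f_0,f_1: X\to Y$ is an isovariant map $X\times[0,1]\to Y$ (trivial action on $[0,1]$) restricting to $f_0,f_1$ at the ends. The isovariant category is the category of $G$-spaces and isovariant maps, with a formal terminal object added. Linking simplices: for a strictly increasing chain of subgroups $\mathbf H=\{H_0<\dots<H_n\}$ of $G$ ($n\ge 0$), $\Delta^{\mathbf H}$ is the quotient of $G\times\Delta^n$ in which, for $x=(t_0,\dots,t_{n-k},0,\dots,0)$ with $t_{n-k}\neq 0$, $(g,x)\sim(g',x)$ iff $gH_k=g'H_k$; $G$ acts by left multiplication on the first coordinate. Its boundary $\partial\Delta^{\mathbf H}$ is the image of $G\times\partial\Delta^n$. Cofibrancy: $\mathcal I$ is the class of pushout-products $(S^{k-1}\times\Delta^{\mathbf H})\cup_{S^{k-1}\times\partial\Delta^{\mathbf H}}(D^k\times\partial\Delta^{\mathbf H})\to D^k\times\Delta^{\mathbf H}$ over all $k\ge 0$ and all strictly increasing chains $\mathbf H$ (trivial action on $S^{k-1},D^k$; $S^{-1}=\emptyset$). $\mathcal I\text{-inj}$ is the class of maps in the isovariant category with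 the right lifting property with respect to $\mathcal I$, and $\mathcal I\text{-cof}$ the class of maps with the left lifting property with respect to $\mathcal I\text{-inj}$. A $G$-space $X$ is $\mathcal I$-cofibrant if $\emptyset\to X$ is in $\mathcal I\text{-cof}$. A complete $G$-universe $\mathcal U$ is any (real) $G$-representation isomorphic to a direct sum of countably many copies of each irreducible $G$-representation; equivalently $\mathcal U\cong\mathrm{colim}_{n}\rho^{\oplus n}$ with the colimit topology, $\rho$ the regular representation of $G$. *)

(* Defs.v *)
From HB Require Import structures.
From Stdlib Require Import Relations.
From mathcomp Require Import all_boot all_order all_algebra all_fingroup.
From mathcomp Require Import generic_quotient mxrepresentation.
From mathcomp Require Import all_classical all_reals all_analysis.

Set Implicit Arguments.
Unset Strict Implicit.
Unset Printing Implicit Defensive.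

Import Order.TTheory GRing.Theory Num.Theory.
Import numFieldNormedType.Exports.

Local Open Scope classical_set_scope.
Local Open Scope ring_scope.
Local Open Scope quotient_scope.

Definition k_open (T : topologicalType) (A : set T) : Prop :=
  forall (K : topologicalType) (f : K -> T),
    compact [set: K] -> hausdorff_space K -> continuous f -> open (f @^-1` A).

Definition compactly_generated (T : topologicalType) : Prop :=
  forall A : set T, k_open A -> open A.

(* [kify T] is T with its k-ification topology. Products and subspaces of
   compactly generated spaces are formed by applying [kify] to the usual product
   and subspace topologies; [kify] does not change a topology that is already
   compactly generated ([kify_openE]). *)
Definition kify (T : topologicalType) : Type := T.

Section Kify.
Variable T : topologicalType.

HB.instance Definition _ := Choice.copy (kify T) T.

Let k_openT : @k_open T [set: T].
Proof. by move=> K f _ _ _; rewrite preimage_setT; exact: openT. Qed.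

Let k_openI : setI_closed (@k_open T).
Proof.
by move=> A B oA oB K f cK hK cf; rewrite preimage_setI; apply: openI;
  [exact: oA|exact: oB].
Qed.

Let k_open_bigU (I : Type) (f : I -> set T) :
  (forall i, k_open (f i)) -> k_open (\bigcup_i f i).
Proof.
move=> of_ K h cK hK ch; rewrite preimage_bigcup.
by apply: bigcup_open => i _; exact: of_.
Qed.

HB.instance Definition _ :=
  @isOpenTopological.Build (kify T) (@k_open T) k_openT k_openI k_open_bigU.

Lemma k_openE (A : set T) : @open (kify T) A = k_open A.
Proof. by []. Qed.

Lemma kify_openE (A : set T) :
  compactly_generated T -> @open (kify T) A = @open T A.
Proof.
move=> cgT; apply/propext; split => [|oA]; rewrite k_openE; first exact: cgT.
by move=> K f _ _ /continuousP cf; exact: cf.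
Qed.

Lemma kify_id_continuous : continuous (id : kify T -> T).
Proof. apply/continuousP => A oA; rewrite k_openE => K f _ _ /continuousP cf.
exact: cf. Qed.

Lemma continuous_to_kify (K : topologicalType) (f : K -> T) :
  compact [set: K] -> hausdorff_space K -> continuous f ->
  continuous (f : K -> kify T).
Proof. by move=> cK hK cf; apply/continuousP => A oA; exact: oA. Qed.

Lemma compactly_generated_kify : compactly_generated (kify T).
Proof.
move=> A oA; rewrite k_openE => K f cK hK cf; apply: (oA K f) => //.
exact: continuous_to_kify.
Qed.

End Kify.

Lemma kify_continuous (S T : topologicalType) (f : S -> T) :
  continuous f -> continuous (f : kify S -> kify T).
Proof.
move=> cf; apply/continuousP => A; rewrite !k_openE => oA K h cK hK ch.
apply: (oA K (f \o h)) => // x.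
by apply: continuous_comp; [exact: ch|exact: cf].
Qed.

Lemma set_type_compact (T : topologicalType) (A : set T) :
  compact A -> compact [set: A].
Proof.
move=> cA F PF _.
have FA : (set_val @ F) A.
  by apply: (@filterS _ F _ setT); [move=> x _; exact: set_valP|exact: filterT].
have [p [Ap clp]] := cA (set_val @ F) _ FA.
exists (SigSub (mem_set Ap)); split=> // B C FB [D [[V oV <-] Vp VC]].
have FB' : (set_val @ F) (set_val @` B).
  by apply: (@filterS _ F _ B) => // x Bx; exists x.
have Vp' : nbhs p V by exact: open_nbhs_nbhs.
have [y [[x Bx <-] Vx]] := clp _ _ FB' Vp'.
by exists x; split=> //; exact: VC.
Qed.

Lemma set_type_hausdorff (T : topologicalType) (A : set T) :
  hausdorff_space T -> hausdorff_space A.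
Proof.
move=> hT p q pq; apply/val_inj; apply: hT => B C pB qC.
have [x [Bx Cx]] := pq _ _ (@initial_continuous A T set_val p B pB)
  (@initial_continuous A T set_val q C qC).
by exists (set_val x).
Qed.

Lemma locally_compact_cg (T : topologicalType) :
  hausdorff_space T -> (forall x : T, exists2 B, nbhs x B & compact B) ->
  compactly_generated T.
Proof.
move=> hT lcT A kA; rewrite openE => x Ax; have [B xB cB] := lcT x.
have [V oV VA] := kA B set_val (set_type_compact cB)
  (@set_type_hausdorff T B hT) (@initial_continuous B T set_val).
have AE y : B y -> V y <-> A y.
  move=> By; have := congr1 (fun X => X (SigSub (mem_set By))) VA.
  by rewrite /preimage/= => ->.
have xV : nbhs x V by apply/open_nbhs_nbhs; split=> //; exact/(AE _ (nbhs_singleton xB)).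
by apply: filterS (filterI xB xV) => y [By]; exact: (AE _ By).1.
Qed.

Lemma rV_cg (R : realType) m : compactly_generated 'rV[R]_m.
Proof.
apply: locally_compact_cg; first exact: norm_hausdorff.
move=> x; exists [set v : 'rV[R]_m | forall i,
    `[x ord0 i - 1, x ord0 i + 1]%classic (v ord0 i)]; last first.
  by apply: (@rV_compact _ _ (fun i => `[x ord0 i - 1, x ord0 i + 1]%classic)) => i;
    exact: segment_compact.
apply: (@filterS _ (nbhs x) _ (ball x 1)); last exact: nbhsx_ballx.
move=> y [_ xy] i; move: (xy ord0 i).
by rewrite -ball_normE /= in_itv /= -ler_distl distrC => /ltW.
Qed.

HB.instance Definition _ := Topological.copy void (discrete_topology void).

Definition sum_space (S T : Type) : Type := (S + T)%type.

Section SumSpace.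
Variables S T : topologicalType.

HB.instance Definition _ := Choice.copy (sum_space S T) (S + T)%type.

Definition sum_open (A : set (sum_space S T)) : Prop :=
  open ((inl : S -> sum_space S T) @^-1` A) /\
  open ((inr : T -> sum_space S T) @^-1` A).

Let sum_openT : sum_open [set: _].
Proof. by split; rewrite preimage_setT; exact: openT. Qed.

Let sum_openI : setI_closed sum_open.
Proof.
by move=> A B [A1 A2] [B1 B2]; split; rewrite preimage_setI; exact: openI.
Qed.

Let sum_open_bigU (I : Type) (f : I -> set (sum_space S T)) :
  (forall i, sum_open (f i)) -> sum_open (\bigcup_i f i).
Proof.
by move=> of_; split; rewrite preimage_bigcup; apply: bigcup_open => i _;
  have [] := of_ i.
Qed.

HB.instance Definition _ := @isOpenTopological.Build (sum_space S T)
  sum_open sum_openT sum_openI sum_open_bigU.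

End SumSpace.

Section QuotSpace.
Variables (T : topologicalType) (r : T -> T -> Prop).

Definition gen_rel : rel T := fun x y => `[< clos_refl_sym_trans T r x y >].

Let gen_refl : reflexive gen_rel.
Proof. by move=> x; apply/asboolP; exact: rst_refl. Qed.

Let gen_sym : symmetric gen_rel.
Proof. by move=> x y; apply/asboolP/asboolP; exact: rst_sym. Qed.

Let gen_trans : transitive gen_rel.
Proof.
by move=> y x z /asboolP xy /asboolP yz; apply/asboolP; exact: rst_trans xy yz.
Qed.

Definition gen_equiv : equiv_rel T := EquivRel gen_rel gen_refl gen_sym gen_trans.

(* r need not be an equivalence relation: the quotient is by the one it
   generates. *)
Definition quot_space : Type := quotient_topology {eq_quot gen_equiv}.
HB.instance Definition _ := Topological.on quot_space.
HB.instance Definition _ := Quotient.on quot_space.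

Definition qpi (x : T) : quot_space := \pi_quot_space%qT x.

Lemma qpi_eqP (x y : T) : qpi x = qpi y <-> clos_refl_sym_trans T r x y.
Proof.
split => [xy|xy].
  by apply/asboolP; apply/(@eqquotP T gen_equiv {eq_quot gen_equiv}).
by apply/(@eqquotP T gen_equiv {eq_quot gen_equiv}); apply/asboolP.
Qed.

End QuotSpace.

(* Since G is finite (discrete), continuity of G * X -> X is continuity of each
   of the maps x |-> g x. *)
Record pre_gspace (G : finGroupType) := PreGSpace {
  gcarrier :> topologicalType;
  gact : G -> gcarrier -> gcarrier;
  gact1 : forall x, gact 1%g x = x;
  gactM : forall g h x, gact (g * h)%g x = gact g (gact h x);
  gact_continuous : forall g, continuous (gact g) }.

Record gspace (G : finGroupType) := GSpace {
  gspace_pre :> pre_gspace G;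
  gspace_cg : compactly_generated gspace_pre }.

Section GSpaces.
Variable G : finGroupType.

Definition isotropy (X : pre_gspace G) (x : X) : set G := [set g | gact g x = x].

Definition equivariant (X Y : pre_gspace G) (f : X -> Y) : Prop :=
  forall g x, f (gact g x) = gact g (f x).

Definition isovariant (X Y : pre_gspace G) (f : X -> Y) : Prop :=
  [/\ continuous f, equivariant f & forall x, isotropy x = isotropy (f x)].

Definition kify_pre (X : pre_gspace G) : pre_gspace G :=
  @PreGSpace G (kify X) (@gact G X) (@gact1 G X) (@gactM G X)
    (fun g => kify_continuous (@gact_continuous G X g)).

Definition kify_gspace (X : pre_gspace G) : gspace G :=
  @GSpace G (kify_pre X) (@compactly_generated_kify X).

Definition trivial_pre (T : topologicalType) : pre_gspace G :=
  @PreGSpace G T (fun _ x => x) (fun _ => erefl) (fun _ _ _ => erefl)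
    (fun _ x => @cvg_id T (nbhs x)).

Definition trivial_gspace (T : topologicalType) : gspace G :=
  kify_gspace (trivial_pre T).

Definition empty_gspace : gspace G := trivial_gspace void.

Section Product.
Variables X Y : pre_gspace G.

Definition prod_act (g : G) (p : (X * Y)%type) : (X * Y)%type :=
  (gact g p.1, gact g p.2).

Lemma prod_act1 p : prod_act 1%g p = p.
Proof. by case: p => x y; rewrite /prod_act !gact1. Qed.

Lemma prod_actM g h p : prod_act (g * h)%g p = prod_act g (prod_act h p).
Proof. by rewrite /prod_act !gactM. Qed.

Lemma prod_map_continuous (S S' T T' : topologicalType)
    (f : S -> S') (h : T -> T') : continuous f -> continuous h ->
  continuous ((fun p => (f p.1, h p.2)) : (S * T)%type -> (S' * T')%type).
Proof.
move=> cf ch p; apply: cvg_pair => /=.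
  by apply: (@continuous_comp _ _ _ fst f); [exact: cvg_fst|exact: cf].
by apply: (@continuous_comp _ _ _ snd h); [exact: cvg_snd|exact: ch].
Qed.

Lemma prod_act_continuous g : continuous (prod_act g).
Proof. by apply: prod_map_continuous; exact: gact_continuous. Qed.

Definition prod_pre : pre_gspace G :=
  @PreGSpace G (X * Y)%type prod_act prod_act1 prod_actM prod_act_continuous.

Definition prod_gspace : gspace G := kify_gspace prod_pre.

End Product.

Section Sub.
Variables (X : pre_gspace G) (A : set X).
Hypothesis A_inv : forall g x, A x -> A (gact g x).

Definition sub_act (g : G) (x : A) : A :=
  SigSub (mem_set (A_inv g (set_mem (valP x)))).

Lemma sub_act1 x : sub_act 1%g x = x.
Proof. by apply/val_inj => /=; rewrite gact1. Qed.

Lemma sub_actM g h x : sub_act (g * h)%g x = sub_act g (sub_act h x).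
Proof. by apply/val_inj => /=; rewrite gactM. Qed.

Lemma sub_act_continuous g : continuous (sub_act g).
Proof.
apply/continuousP => U [V oV <-].
exists (gact g @^-1` V); last by [].
by apply: open_comp => // x _; exact: gact_continuous.
Qed.

Definition sub_pre : pre_gspace G :=
  @PreGSpace G A sub_act sub_act1 sub_actM sub_act_continuous.

Definition sub_gspace : gspace G := kify_gspace sub_pre.

Definition sub_incl : sub_gspace -> X := fun x => set_val (x : A).

Lemma sub_incl_inj : injective sub_incl.
Proof. exact: val_inj. Qed.

Lemma sub_incl_isovariant : isovariant sub_incl.
Proof.
split=> [x|//|x].
  apply: (@continuous_comp _ _ _ (id : kify A -> A) set_val).
    exact: kify_id_continuous.
  exact: initial_continuous.
apply/seteqP; split => g; rewrite /isotropy /sub_incl /=.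
  by move=> {2}<-.
by move=> gx; exact/val_inj.
Qed.

End Sub.

Section Sum.
Variables X Y : pre_gspace G.

Definition sum_act (g : G) (p : sum_space X Y) : sum_space X Y :=
  match p with inl x => inl (gact g x) | inr y => inr (gact g y) end.

Lemma sum_act1 p : sum_act 1%g p = p.
Proof. by case: p => x /=; rewrite gact1. Qed.

Lemma sum_actM g h p : sum_act (g * h)%g p = sum_act g (sum_act h p).
Proof. by case: p => x /=; rewrite gactM. Qed.

Lemma sum_act_continuous g : continuous (sum_act g).
Proof.
apply/continuousP => U [U1 U2]; split.
  by move/continuousP : (@gact_continuous G X g) => /(_ _ U1).
by move/continuousP : (@gact_continuous G Y g) => /(_ _ U2).
Qed.

Definition sum_pre : pre_gspace G :=
  @PreGSpace G (sum_space X Y) sum_act sum_act1 sum_actM sum_act_continuous.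

End Sum.

Section Quotient.
Variables (X : pre_gspace G) (r : X -> X -> Prop).
Hypothesis r_inv : forall g x y, r x y -> r (gact g x) (gact g y).

Lemma gen_inv g x y : clos_refl_sym_trans X r x y ->
  clos_refl_sym_trans X r (gact g x) (gact g y).
Proof.
elim=> [{}x {}y xy|{}x|{}x {}y _|{}x {}y z _ xy _ yz].
- exact/rst_step/r_inv.
- exact: rst_refl.
- exact: rst_sym.
- exact: rst_trans xy yz.
Qed.

Definition quot_act (g : G) (q : quot_space r) : quot_space r :=
  qpi r (gact g (repr q)).

Lemma quot_actE g x : quot_act g (qpi r x) = qpi r (gact g x).
Proof. by apply/qpi_eqP/gen_inv/qpi_eqP; rewrite /qpi reprK. Qed.

Lemma qpi_surj (q : quot_space r) : exists x, q = qpi r x.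
Proof. by exists (repr q); rewrite /qpi reprK. Qed.

Lemma quot_act1 q : quot_act 1%g q = q.
Proof. by have [x ->] := qpi_surj q; rewrite quot_actE gact1. Qed.

Lemma quot_actM g h q : quot_act (g * h)%g q = quot_act g (quot_act h q).
Proof. by have [x ->] := qpi_surj q; rewrite !quot_actE gactM. Qed.

Lemma qpi_continuous : continuous (qpi r).
Proof. exact: pi_continuous. Qed.

Lemma quot_act_continuous g : continuous (quot_act g).
Proof.
apply/quotient_continuous.
have -> : quot_act g \o \pi_(quotient_topology _) = qpi r \o gact g.
  by apply/funext => x /=; exact: quot_actE.
move=> x; apply: continuous_comp; [exact: gact_continuous|exact: qpi_continuous].
Qed.

Definition quot_pre : pre_gspace G :=
  @PreGSpace G (quot_space r) quot_act quot_act1 quot_actM quot_act_continuous.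

Definition quot_gspace : gspace G := kify_gspace quot_pre.

End Quotient.

End GSpaces.

Section Pushout.
Variables (G : finGroupType) (C X Y : pre_gspace G) (f : C -> X) (h : C -> Y).
Hypotheses (f_eq : equivariant f) (h_eq : equivariant h).

Definition pushout_rel (p q : sum_pre X Y) : Prop :=
  exists c, p = inl (f c) /\ q = inr (h c).

Lemma pushout_rel_inv g p q :
  pushout_rel p q -> pushout_rel (gact g p) (gact g q).
Proof. by move=> [c [-> ->]]; exists (gact g c); rewrite f_eq h_eq. Qed.

Definition pushout_gspace : gspace G := quot_gspace pushout_rel_inv.

Definition pushout_inl (x : X) : pushout_gspace :=
  qpi pushout_rel (inl x : sum_space X Y).
Definition pushout_inr (y : Y) : pushout_gspace :=
  qpi pushout_rel (inr y : sum_space X Y).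

Lemma pushout_ind (P : pushout_gspace -> Prop) :
  (forall x, P (pushout_inl x)) -> (forall y, P (pushout_inr y)) ->
  forall p, P p.
Proof.
move=> Pl Pr p; have [q ->] := @qpi_surj G (sum_pre X Y) pushout_rel p.
by case: q => [x|y]; [exact: Pl|exact: Pr].
Qed.

Lemma pushout_glue c : pushout_inl (f c) = pushout_inr (h c).
Proof. by apply/qpi_eqP/rst_step; exists c. Qed.

Lemma pushout_act_inl g x : gact g (pushout_inl x) = pushout_inl (gact g x).
Proof. exact: (@quot_actE _ _ _ pushout_rel_inv). Qed.

Lemma pushout_act_inr g y : gact g (pushout_inr y) = pushout_inr (gact g y).
Proof. exact: (@quot_actE _ _ _ pushout_rel_inv). Qed.

Section Universal.
Variables (Z : pre_gspace G) (u : X -> Z) (v : Y -> Z).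
Hypothesis uv : forall c, u (f c) = v (h c).

Definition sum_map (p : sum_space X Y) : Z :=
  match p with inl x => u x | inr y => v y end.

Definition pushout_map (p : pushout_gspace) : Z :=
  sum_map (repr (p : quot_space pushout_rel)).

Lemma pushout_map_qpi p : pushout_map (qpi pushout_rel p) = sum_map p.
Proof.
have : clos_refl_sym_trans _ pushout_rel (repr (qpi pushout_rel p)) p.
  by apply/qpi_eqP; rewrite /qpi reprK.
rewrite /pushout_map; move: (repr _) => q.
by elim=> [x y [c [-> ->]]|x|x y _ ->|x y z _ -> _ ->] //=.
Qed.

Lemma pushout_map_inl x : pushout_map (pushout_inl x) = u x.
Proof. exact: pushout_map_qpi. Qed.

Lemma pushout_map_inr y : pushout_map (pushout_inr y) = v y.
Proof. exact: pushout_map_qpi. Qed.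

Lemma pushout_map_equivariant :
  equivariant u -> equivariant v -> equivariant pushout_map.
Proof.
move=> u_eq v_eq g; apply: pushout_ind => [x|y].
  by rewrite pushout_act_inl !pushout_map_inl.
by rewrite pushout_act_inr !pushout_map_inr.
Qed.

Lemma pushout_map_continuous :
  continuous u -> continuous v -> continuous pushout_map.
Proof.
move=> cu cv x.
apply: (@continuous_comp (kify (quot_space pushout_rel))
  (quot_space pushout_rel) Z id pushout_map).
  exact: kify_id_continuous.
move: (x : quot_space pushout_rel) => {x}.
change (continuous (pushout_map : quot_space pushout_rel -> Z)).
apply/quotient_continuous.
have -> : (pushout_map : quot_space pushout_rel -> Z)
    \o \pi_(quotient_topology _) = sum_map.
  by apply/funext => p /=; exact: pushout_map_qpi.
apply/continuousP => U oU; split.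
  by move/continuousP : cu => /(_ _ oU).
by move/continuousP : cv => /(_ _ oU).
Qed.

End Universal.
End Pushout.

Lemma inj_isovariant (G : finGroupType) (X Y : pre_gspace G) (f : X -> Y) :
  continuous f -> equivariant f -> injective f -> isovariant f.
Proof.
move=> cf ef f_inj; split=> // x; apply/seteqP; split=> g; rewrite /isotropy /=.
  by rewrite -ef => ->.
by rewrite -ef => /f_inj.
Qed.

Section PushoutProduct.
Variables (G : finGroupType) (A B K L : gspace G) (i : A -> B) (j : K -> L).
Hypotheses (iI : isovariant i) (jI : isovariant j).
Hypotheses (i_inj : injective i) (j_inj : injective j).

Definition pp_left (p : prod_gspace A K) : prod_gspace A L := (p.1, j p.2).
Definition pp_top (p : prod_gspace A K) : prod_gspace B K := (i p.1, p.2).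

Lemma pp_left_equivariant : equivariant pp_left.
Proof. by case: jI => _ ej _ g [a k]; rewrite /pp_left /= ej. Qed.

Lemma pp_top_equivariant : equivariant pp_top.
Proof. by case: iI => _ ei _ g [a k]; rewrite /pp_top /= ei. Qed.

Definition pp_gspace : gspace G :=
  pushout_gspace pp_left_equivariant pp_top_equivariant.

Definition pp_u (p : prod_gspace A L) : prod_gspace B L := (i p.1, p.2).
Definition pp_v (p : prod_gspace B K) : prod_gspace B L := (p.1, j p.2).

Lemma pp_compat c : pp_u (pp_left c) = pp_v (pp_top c).
Proof. by []. Qed.

Definition pushout_product : pp_gspace -> prod_gspace B L :=
  pushout_map pp_u pp_v.

Lemma pushout_product_inj : injective pushout_product.
Proof.
rewrite /pushout_product.
apply: pushout_ind => [[a l]|[b k]]; apply: pushout_ind => [[a' l']|[b' k']];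
  rewrite !(pushout_map_inl _ _ pp_compat, pushout_map_inr _ _ pp_compat);
  rewrite /pp_u /pp_v /= => -[].
- by move=> /i_inj -> ->.
- by move=> <- ->; exact: (pushout_glue pp_left_equivariant pp_top_equivariant (a, k')).
- move=> -> <-; apply/esym.
  exact: (pushout_glue pp_left_equivariant pp_top_equivariant (a', k)).
- by move=> -> /j_inj ->.
Qed.

Lemma pushout_product_isovariant : isovariant pushout_product.
Proof.
have [[ci ei _] [cj ej _]] := (iI, jI).
apply: inj_isovariant; last exact: pushout_product_inj.
  apply: (pushout_map_continuous pp_compat).
    apply: (@kify_continuous (A * L)%type (B * L)%type pp_u).
    by apply: (@prod_map_continuous _ _ _ _ i id) => // x; exact: cvg_id.
  apply: (@kify_continuous (B * K)%type (B * L)%type pp_v).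
  by apply: (@prod_map_continuous _ _ _ _ id j) => // x; exact: cvg_id.
apply: (pushout_map_equivariant pp_compat) => g [x y].
  by rewrite /pp_u /= ei.
by rewrite /pp_v /= ej.
Qed.

End PushoutProduct.

Section Category.
Variable G : finGroupType.

(* [None] is the formal terminal object. *)
Definition iso_obj := option (gspace G).

Definition iso_hom (A B : iso_obj) : Type :=
  match A, B with
  | Some X, Some Y => {f : X -> Y | isovariant f}
  | None, Some _ => void
  | _, None => unit
  end.

Lemma isovariant_comp (X Y Z : gspace G) (f : X -> Y) (h : Y -> Z) :
  isovariant f -> isovariant h -> isovariant (h \o f).
Proof.
move=> [cf ef xf] [ch eh xh]; split=> [x|g x|x] /=.
- by apply: continuous_comp; [exact: cf|exact: ch].
- by rewrite ef eh.
- by rewrite xf xh.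
Qed.

Definition iso_comp (A B C : iso_obj) :
    iso_hom B C -> iso_hom A B -> iso_hom A C :=
  match A, B, C with
  | Some X, Some Y, Some Z =>
      fun h f => exist _ (sval h \o sval f) (isovariant_comp (svalP f) (svalP h))
  | Some _, None, Some _ => fun h _ => match h with end
  | None, Some _, Some _ => fun _ f => f
  | None, None, Some _ => fun h _ => h
  | Some _, _, None => fun _ _ => tt
  | None, _, None => fun _ _ => tt
  end.

Definition mor_class := forall A B : iso_obj, iso_hom A B -> Prop.

Definition has_lift (A B E F : iso_obj) (i : iso_hom A B) (p : iso_hom E F) :=
  forall (u : iso_hom A E) (v : iso_hom B F),
    iso_comp p u = iso_comp v i ->
    exists h : iso_hom B E, iso_comp h i = u /\ iso_comp p h = v.

Definition inj_class (I : mor_class) : mor_class :=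
  fun E F p => forall A B (i : iso_hom A B), I A B i -> has_lift i p.

Definition cof_class (I : mor_class) : mor_class :=
  fun A B i => forall E F (p : iso_hom E F), inj_class I p -> has_lift i p.

Definition from_empty (X : gspace G) : empty_gspace G -> X :=
  fun x => match (x : void) with end.

Lemma from_empty_isovariant (X : gspace G) : isovariant (@from_empty X).
Proof. by split=> [x|g x|x]; exfalso; move: (x : void); case. Qed.

Definition empty_hom (X : gspace G) : iso_hom (Some (empty_gspace G)) (Some X) :=
  exist _ (@from_empty X) (@from_empty_isovariant X).

End Category.

Definition simplex (R : realType) (n : nat) : set 'rV[R]_n.+1 :=
  [set t | (forall i, 0 <= t 0 i) /\ \sum_i t 0 i = 1].
Arguments simplex : clear implicits.

Definition disc (R : realType) (k : nat) : set 'rV[R]_k :=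
  [set x | \sum_i x 0 i ^+ 2 <= 1].
Arguments disc : clear implicits.

Definition unit_interval (R : realType) : set R := [set t | 0 <= t <= 1].
Arguments unit_interval : clear implicits.

Record chain (G : finGroupType) (n : nat) := Chain {
  chain_grp :> 'I_n.+1 -> {group G};
  chain_strict : forall i j : 'I_n.+1, (i < j)%N ->
    chain_grp i \proper chain_grp j }.

Section LinkingSimplex.
Variables (R : realType) (G : finGroupType).

Lemma mulg_continuous g :
  continuous (mulg g : discrete_topology G -> discrete_topology G).
Proof. by apply/continuousP => U _; exact: discrete_open. Qed.

Definition left_translation_pre : pre_gspace G :=
  @PreGSpace G (discrete_topology G) mulg (@mul1g G)
    (fun g h x => esym (mulgA g h x)) mulg_continuous.

Variables (n : nat) (H : chain G n).

Definition link_total : pre_gspace G :=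
  prod_pre left_translation_pre (trivial_pre G (simplex R n)).

(* [m] is the last index with [t_m <> 0], so m = n - k and k = rev_ord m. *)
Definition link_rel (p q : link_total) : Prop :=
  p.2 = q.2 /\
  let t : 'rV[R]_n.+1 := set_val p.2 in
  exists m : 'I_n.+1,
    [/\ t 0 m != 0, forall j : 'I_n.+1, (m < j)%N -> t 0 j = 0 &
        lcoset (H (rev_ord m)) p.1 = lcoset (H (rev_ord m)) q.1].

Lemma link_rel_inv g p q : link_rel p q -> link_rel (gact g p) (gact g q).
Proof.
case: p q => [a x] [b y] [/= -> [m [tm tj ab]]]; split=> //=; exists m.
by split=> //; rewrite !lcosetE !lcosetM -!lcosetE ab.
Qed.

Definition linking_simplex : gspace G := quot_gspace link_rel_inv.

Definition link_boundary : set linking_simplex :=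
  qpi link_rel @` [set p : link_total | exists i, (set_val p.2 : 'rV[R]_n.+1) 0 i = 0].

Lemma link_boundary_inv (g : G) (x : linking_simplex) :
  link_boundary x -> link_boundary (gact g x).
Proof.
move=> [p [i pi0] <-]; exists (gact g p); first by exists i.
by rewrite -(quot_actE link_rel_inv).
Qed.

Definition boundary_simplex : gspace G := sub_gspace link_boundary_inv.
Definition boundary_incl : boundary_simplex -> linking_simplex :=
  @sub_incl G linking_simplex link_boundary link_boundary_inv.

End LinkingSimplex.

Section GeneratingClass.
Variables (R : realType) (G : finGroupType).

Definition disc_gspace k : gspace G := trivial_gspace G (disc R k).

(* For k = 0 this is empty, i.e. the sphere of dimension -1. *)
Definition sphere k : set (disc_gspace k) :=
  [set x | \sum_i (set_val (x : disc R k) : 'rV[R]_k) 0 i ^+ 2 = 1].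

Lemma sphere_inv k (g : G) (x : disc_gspace k) : sphere x -> sphere (gact g x).
Proof. by []. Qed.

Definition sphere_gspace k : gspace G := sub_gspace (@sphere_inv k).
Definition sphere_incl k : sphere_gspace k -> disc_gspace k :=
  @sub_incl G (disc_gspace k) (@sphere k) (@sphere_inv k).

Section Generator.
Variables (k n : nat) (H : chain G n).

Let iI := @sub_incl_isovariant G (disc_gspace k) (@sphere k) (@sphere_inv k).
Let jI := @sub_incl_isovariant G (linking_simplex R H) _
  (@link_boundary_inv R G n H).

Definition gen_source : gspace G := pp_gspace iI jI.
Definition gen_target : gspace G :=
  prod_gspace (disc_gspace k) (linking_simplex R H).

Definition gen_map : gen_source -> gen_target := @pushout_product _ _ _ _ _ _ _ iI jI.

Lemma gen_map_isovariant : isovariant gen_map.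
Proof. by apply: pushout_product_isovariant; exact: sub_incl_inj. Qed.

Definition gen_hom : iso_hom (Some gen_source) (Some gen_target) :=
  exist _ gen_map gen_map_isovariant.

End Generator.

Inductive I_gen : mor_class G :=
  | IGen k n (H : chain G n) : I_gen (gen_hom k H).

Definition I_cofibrant (X : gspace G) : Prop := cof_class I_gen (empty_hom X).

Definition isovariant_homotopic (X Y : gspace G) (f0 f1 : X -> Y) : Prop :=
  exists h : prod_gspace X (trivial_gspace G (unit_interval R)) -> Y,
    [/\ isovariant h,
        forall (x : X) (t : unit_interval R), set_val t = 0 :> R -> h (x, t) = f0 x &
        forall (x : X) (t : unit_interval R), set_val t = 1 :> R -> h (x, t) = f1 x].

End GeneratingClass.

(* Unlike [mx_representation], V may be infinite-dimensional. *)
Record grep (R : realType) (G : finGroupType) := GRep {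
  grep_mod :> lmodType R;
  grep_act : G -> {linear grep_mod -> grep_mod};
  grep_act1 : forall v, grep_act 1%g v = v;
  grep_actM : forall g h v, grep_act (g * h)%g v = grep_act g (grep_act h v) }.
Arguments grep_act {R G V} _ : rename.

(* V with the colimit topology of its finite-dimensional subspaces: A is open
   iff its preimage under every linear map R^m -> V is open. *)
Definition colim_space (R : realType) (V : lmodType R) : Type := V.

Section ColimSpace.
Variables (R : realType) (V : lmodType R).

HB.instance Definition _ := Choice.copy (colim_space V) V.

Definition colim_open (A : set (colim_space V)) : Prop :=
  forall m (phi : {linear 'rV[R]_m -> V}), open (phi @^-1` A).

Let colim_openT : colim_open [set: _].
Proof. by move=> m phi; rewrite preimage_setT; exact: openT. Qed.

Let colim_openI : setI_closed colim_open.
Proof.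
by move=> A B oA oB m phi; rewrite preimage_setI; apply: openI;
  [exact: oA|exact: oB].
Qed.

Let colim_open_bigU (I : Type) (f : I -> set (colim_space V)) :
  (forall i, colim_open (f i)) -> colim_open (\bigcup_i f i).
Proof.
move=> of_ m phi; rewrite preimage_bigcup.
by apply: bigcup_open => i _; exact: of_.
Qed.

HB.instance Definition _ := @isOpenTopological.Build (colim_space V)
  colim_open colim_openT colim_openI colim_open_bigU.

Lemma colim_openE (A : set (colim_space V)) : open A = colim_open A.
Proof. by []. Qed.

Lemma linear_colim_continuous m (phi : {linear 'rV[R]_m -> V}) :
  continuous (phi : 'rV[R]_m -> colim_space V).
Proof. by apply/continuousP => A oA; exact: oA. Qed.

Lemma colim_space_cg : compactly_generated (colim_space V).
Proof.
move=> A kA; rewrite colim_openE => m phi; apply: rV_cg => K f cK hK cf.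
apply: (kA K (phi \o f)) => // x.
by apply: continuous_comp; [exact: cf|exact: linear_colim_continuous].
Qed.

End ColimSpace.

Section Universe.
Variables (R : realType) (G : finGroupType) (U : grep R G).

Lemma grep_act_continuous g :
  continuous (grep_act g : colim_space U -> colim_space U).
Proof.
apply/continuousP => A oA; rewrite colim_openE => m phi.
exact: (oA m (grep_act g \o phi : {linear _ -> _})).
Qed.

Definition grep_pre : pre_gspace G :=
  @PreGSpace G (colim_space U) (fun g => grep_act g) (@grep_act1 R G U)
    (@grep_actM R G U) grep_act_continuous.

Definition grep_gspace : gspace G := @GSpace G grep_pre (@colim_space_cg R U).

(* [irr_repr i], i : sG, runs over the irreducible real representations of G up
   to isomorphism. These act on row vectors on the right, whence the inverse in
   the equivariance condition. [Phi] identifies U with the direct sum of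
   countably many copies of each of them: the finitely supported families of
   vectors indexed by sG * nat. *)
Definition complete_universe : Prop :=
  exists (sG : irrType R [set: G]%G)
         (Phi : U -> forall k : sG * nat, 'rV[R]_(irr_degree k.1)),
    [/\ forall (a : R) (u v : U) k, Phi (a *: u + v) k = a *: Phi u k + Phi v k,
        forall g u k, Phi (grep_act g u) k = Phi u k *m irr_repr k.1 g^-1%g,
        injective Phi &
        range Phi = [set x | finite_set [set k | x k != 0]]].

End Universe.

(* Main.v *)
From HB Require Import structures.
From Stdlib Require Import Relations.
From mathcomp Require Import all_boot all_order all_algebra all_fingroup.
From mathcomp Require Import generic_quotient pgroup mxrepresentation.
From mathcomp Require Import all_classical all_reals all_analysis.
Require Import Defs.

Set Implicit Arguments.
Unset Strict Implicit.
Unset Printing Implicit Defensive.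

Import Order.TTheory GRing.Theory Num.Theory.
Import numFieldNormedType.Exports.

Local Open Scope classical_set_scope.
Local Open Scope ring_scope.
Local Open Scope quotient_scope.

(** The universe is a sum of countably many copies of one finite-dimensional
    representation V, indexed by levels n = 0, 1, 2, ..., where V contains
    every irreducible representation once.  The theorem follows from the room
    that infinitely many levels provide.

    Existence.  Lifting against the map from U to the terminal object shows
    that it is enough for this map to be in I-inj
    ([universe_terminal_injective]), that is, to extend an isovariant map u
    along each generator A -> B, where B is the product of a disc and a linking
    simplex.  Here A and B are compact Hausdorff and A is closed in B.  A
    compact subset of U meets only finitely many levels
    ([compact_levels_bounded]), so u has finitely many real coordinates; they
    extend to B by Tietze's theorem, and averaging over G makes the extension v
    equivariant ([equivariant_extension]).  By equivariance v can only have
    isotropy groups that are too large off A.  This is repaired by adding an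
    equivariant map w with values in levels that v does not reach, which
    vanishes on A and has exact isotropy off A ([isovariant_extension]).  On
    the point (x, [g, t]), such a w is (1 - |x|^2) (t_0 ... t_n) g e, where e
    is a vector with isotropy group exactly H_0; it exists by
    [exact_isotropy_vector], because for every g outside of a subgroup H some
    irreducible representation has a vector fixed by H and not by g
    ([irr_fix_separates], a consequence of Maschke's theorem).

    Uniqueness.  Let J0 and J1 be the equivariant linear maps from U to U that
    move level n to levels 2n+1 and 2n+2.  Then
      h(x, t) = (1 - t) f0(x) + t f1(x) + t (1 - t) (J0 f0(x) + J1 f1(x))
    is a homotopy from f0 to f1.  For 0 < t < 1 it is isovariant since
    (1 - t) a + t b + t (1 - t) (J0 a + J1 b) determines the pair (a, b): if it
    vanishes and N is the top level where a or b is nonzero, then the levels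
    2N+1 and 2N+2, both above N, give a contradiction ([interleaving]). *)

(** * Fixed vectors in irreducible representations *)

Section Separation.
Variables (R : realType) (G : finGroupType).
Local Notation aG := (regular_repr R [set: G]%G).

(** Otherwise the element of the group ring given by the sum over h in H of
    hg - h would act as zero on every irreducible representation, since it sends
    a vector v to the difference between g applied to an H-fixed vector and
    that vector. By Maschke's theorem it would then act as zero on the regular
    representation. *)
Lemma irr_fix_separates (sG : irrType R [set: G]%G) (H : {group G}) (g : G) :
  g \notin H ->
  exists (i : sG) (v : 'rV[R]_(irr_degree i)),
    (forall h, h \in H -> v *m irr_repr i h = v) /\ v *m irr_repr i g != v.
Proof.
move=> gH; apply: contrapT => noV.
have fixg (i : sG) (v : 'rV[R]_(irr_degree i)) :
    (forall h, h \in H -> v *m irr_repr i h = v) -> v *m irr_repr i g = v.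
  by move=> vH; apply/eqP/negPn/negP => vg; apply: noV; exists i, v.
pose D := \sum_(h in H) (aG (h * g)%g - aG h).
have baseD (i : sG) : socle_base i *m D = 0.
  apply/row_matrixP => k; rewrite row_mul row0; set u := row k _.
  have uS : (u <= socle_base i)%MS by rewrite row_sub.
  have actE x : u *m aG x = val_submod (in_submod (socle_base i) u *m irr_repr i x).
    by rewrite irr_reprE val_submodJ ?in_setT // in_submodK.
  pose v := in_submod (socle_base i) u *m \sum_(h in H) irr_repr i h.
  have vg : v *m irr_repr i g = v.
    apply: fixg => h hH; rewrite /v -mulmxA mulmx_suml; congr (_ *m _).
    rewrite [RHS](reindex_inj (mulIg h)) /=.
    apply: eq_big => [x|x _]; first by rewrite groupMr.
    by rewrite repr_mxM ?in_setT.
  transitivity (val_submod (v *m irr_repr i g - v)); last by rewrite vg subrr linear0.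
  rewrite /D /v mulmx_sumr -mulmxA mulmx_suml !mulmx_sumr -sumrB linear_sum.
  apply: eq_bigr => h _; rewrite mulmxBr !actE -linearB.
  by rewrite repr_mxM ?in_setT.
have D0 : D = 0.
  have charG : ([pchar R]^').-group%g [set: G]%G.
    by rewrite /pgroup pcharf'_nat pnatr_eq0 -lt0n cardG_gt0.
  have S1 := reducible_Socle1 sG (mx_Maschke_pchar _ charG).
  suff : (1%:M <= kermx D)%MS by rewrite sub_kermx mul1mx => /eqP.
  rewrite -S1; apply/sumsmx_subP => i _.
  have [I [W isoW WE]] := component_mx_def (socle_simple i).
  rewrite /socle_val WE.
  apply/sumsmx_subP => j _; have [f _ /hom_mxP hom_f <-] := isoW j.
  rewrite sub_kermx.
  suff -> : socle_base i *m f *m D = socle_base i *m D *m f by rewrite baseD mul0mx.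
  rewrite /D !mulmx_sumr mulmx_suml; apply: eq_bigr => h _.
  by rewrite !mulmxBr mulmxBl !hom_f ?in_setT.
have rowE x y : aG x (gring_index _ 1%g) (gring_index _ y) = (x == y)%:R.
  rewrite mxE gring_indexK ?in_setT // mul1g mxE eqxx /=; congr (nat_of_bool _)%:R.
  rewrite eq_sym; apply/eqP/eqP => [|-> //].
  by move/(congr1 enum_val); rewrite !gring_indexK ?in_setT.
(* the entry of D at (1, g) is 1, as g is not in H *)
have := congr1 (fun M : 'M[R]_(_, _) =>
  M (gring_index [set: G]%G 1%g) (gring_index _ g)) D0.
rewrite /D summxE [X in _ = X]mxE (bigD1 1%g) //= big1 ?addr0 => [|h /andP[hH h1]].
  rewrite mul1g mxE [X in _ + X]mxE !rowE eqxx.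
  have [g1|_] := eqVneq 1%g g; first by rewrite -g1 group1 in gH.
  by rewrite subr0 => /eqP; rewrite oner_eq0.
rewrite mxE [X in _ + X]mxE !rowE.
have -> : (h * g == g)%g = false by rewrite -{2}[g]mul1g (inj_eq (mulIg g)) (negbTE h1).
have [hg|_] := eqVneq h g; [by rewrite -hg hH in gH | by rewrite subrr].
Qed.
End Separation.

(** * The universe as a sum of levels *)

(** A decomposition of U into countably many copies (levels) of one
    representation on {ffun lc_index -> R}: [lc n u] is the level n component
    of u. The action [lc_act] is the same on all levels, which makes moving
    levels around equivariant, and [lc_sep] says that all subgroups can be
    detected on a level. *)
Record level_coords (R : realType) (G : finGroupType) (U : grep R G) := LevelCoords {
  lc_index : finType;
  lc_act : G -> {ffun lc_index -> R^o} -> {ffun lc_index -> R^o};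
  lc : nat -> {linear U -> {ffun lc_index -> R^o}};
  lcJ : forall g u n, lc n (grep_act g u) = lc_act g (lc n u);
  lc_eq0 : forall u, (forall n, lc n u = 0) -> u = 0;
  lc_finite : forall u, exists N, forall n, (N <= n)%N -> lc n u = 0;
  lc_surj : forall (x : nat -> {ffun lc_index -> R^o}) N,
    (forall n, (N <= n)%N -> x n = 0) -> exists u, forall n, lc n u = x n;
  lc_sep : forall (H : {group G}) g, g \notin H ->
    exists v, (forall h, h \in H -> lc_act h v = v) /\ lc_act g v != v }.

Section LevelCoordsExist.
Variables (R : realType) (G : finGroupType) (U : grep R G).
Variables (sG : irrType R [set: G]%G)
  (Phi : U -> forall k : sG * nat, 'rV[R]_(irr_degree k.1)).
Local Notation T := {i : sG & 'I_(irr_degree i)}.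

Definition level (n : nat) (u : U) : {ffun T -> R^o} :=
  [ffun s => Phi u (tag s, n) 0 (tagged s)].

Definition level_row (v : {ffun T -> R^o}) (i : sG) : 'rV[R]_(irr_degree i) :=
  \row_j v (Tagged (fun i : sG => 'I_(irr_degree i)) j).

Definition level_act (g : G) (v : {ffun T -> R^o}) : {ffun T -> R^o} :=
  [ffun s => (level_row v (tag s) *m irr_repr (tag s) g^-1%g) 0 (tagged s)].

Lemma level_rowK n u i : level_row (level n u) i = Phi u (i, n).
Proof. by apply/rowP => j; rewrite !mxE ffunE. Qed.

End LevelCoordsExist.

(** Level n gathers the n-th copies of all the irreducible representations;
    there are finitely many of these, so that finite support amounts to being
    zero from some level on. *)
Lemma complete_universe_level_coords (R : realType) (G : finGroupType) (U : grep R G) :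
  complete_universe U -> inhabited (level_coords U).
Proof.
move=> [sG [Phi [PhiD PhiJ Phi_inj Phi_ran]]].
have Phi_fin u : finite_set [set k | Phi u k != 0].
  by have : range Phi (Phi u) by [exists u]; rewrite Phi_ran.
have lev_lin n : linear (level Phi n).
  by move=> a u v; apply/ffunP => s; rewrite !ffunE PhiD !mxE.
pose lev n : {linear U -> _} :=
  HB.pack (level Phi n) (GRing.isLinear.Build _ _ _ _ (level Phi n) (lev_lin n)).
have rowE (v : {ffun {i : sG & 'I_(irr_degree i)} -> R^o})
    (s : {i : sG & 'I_(irr_degree i)}) :
    v s = level_row v (tag s) 0 (tagged s).
  by rewrite mxE; case: s.
split; apply: (@LevelCoords _ _ _ _ (@level_act R G sG) lev).
- move=> g u n; apply/ffunP => s; rewrite !ffunE PhiJ /=.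
  by rewrite level_rowK.
- move=> u u0; apply: Phi_inj; apply: functional_extensionality_dep => -[i n].
  rewrite -!level_rowK; congr (level_row _ i).
  by rewrite -[LHS]/(lev n u) -[RHS]/(lev n 0) u0 linear0.
- move=> u; have /finite_seqP [F FE] := Phi_fin u.
  exists (\max_(k <- F) k.2).+1 => n nF; apply/ffunP => s; rewrite !ffunE.
  apply/eqP/negPn/negP => nz.
  have : [set` F] (tag s, n) by rewrite -FE; apply: contra_neq nz => /= ->; rewrite mxE.
  move=> /= sF.
  have := leq_bigmax_seq (P := xpredT) (F := fun k : sG * nat => k.2)
    (tag s, n) sF isT.
  by rewrite leqNgt nF.
- move=> x N x0.
  have : range Phi (fun k => level_row (x k.2) k.1).
    rewrite Phi_ran /=; apply: (@sub_finite_set _ _ ([set: sG] `*` `I_N)).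
      move=> [i n] /= nz; split => //=; rewrite ltnNge; apply: contra_neqN nz => Nn.
      by apply/rowP => j; rewrite !mxE x0 // ffunE.
    exact: finite_setX.
  move=> [u _ uE]; exists u => n; apply/ffunP => s; rewrite ffunE uE.
  by rewrite [RHS]rowE.
- move=> H g gH.
  have gH' : (g^-1)%g \notin H by rewrite groupV.
  have [i [v [vH vg]]] := irr_fix_separates sG gH'.
  (* v in the summand of index i, zero in the other ones *)
  pose w : {ffun {i : sG & 'I_(irr_degree i)} -> R^o} :=
    [ffun s => if tag s =P i is ReflectT e
       then (ecast i 'rV[R]_(irr_degree i) (esym e) v) 0 (tagged s) else 0].
  have wi : level_row w i = v.
    apply/rowP => j; rewrite mxE ffunE /=; case: eqP => // e.
    by rewrite (eq_irrelevance e erefl).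
  have wj j : j != i -> level_row w j = 0.
    move=> ji; apply/rowP => k; rewrite !mxE ffunE /=.
    by case: eqP ji => // ->; rewrite eqxx.
  exists w; split => [h hH|].
    apply/ffunP => s; rewrite ffunE [RHS]rowE.
    case: s => j k /=; case: (eqVneq j i) k => [->|ji] k.
      by rewrite wi vH // groupV.
    by rewrite wj // mul0mx.
  apply: contra_neq vg => /ffunP wg; apply/rowP => j.
  have := wg (Tagged (fun i : sG => 'I_(irr_degree i)) j).
  by rewrite ffunE [RHS]rowE /= wi.
Qed.

(** * Continuity of maps into the universe *)

Section RealContinuity.
Variables (R : realType) (T : topologicalType).
Implicit Types f h : T -> R.

Lemma continuousD_real f h :
  continuous f -> continuous h -> continuous (fun x => f x + h x).
Proof. by move=> cf ch x; apply: cvgD; [exact: cf|exact: ch]. Qed.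

Lemma continuousM_real f h :
  continuous f -> continuous h -> continuous (fun x => f x * h x).
Proof. by move=> cf ch x; apply: cvgM; [exact: cf|exact: ch]. Qed.

Lemma continuous_abs_real f : continuous f -> continuous (fun x => `|f x|).
Proof. by move=> cf x; apply: cvg_norm; exact: cf. Qed.

Lemma continuous_sum_real (I : Type) (r : seq I) (f : I -> T -> R) :
  (forall i, continuous (f i)) -> continuous (fun x => \sum_(i <- r) f i x).
Proof.
move=> cf; apply: continuous_big => [|i _]; [exact: add_continuous|exact: cf].
Qed.

Lemma continuous_prod_real (I : Type) (r : seq I) (f : I -> T -> R) :
  (forall i, continuous (f i)) -> continuous (fun x => \prod_(i <- r) f i x).
Proof.
move=> cf; apply: continuous_big => [|i _]; [exact: mul_continuous|exact: cf].
Qed.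

Lemma continuous_row m (a : 'I_m -> T -> R) :
  (forall j, continuous (a j)) -> continuous (fun x => \row_j a j x : 'rV[R]_m).
Proof.
move=> ca x; apply/cvg_ballP => e e0.
have : \forall y \near x, forall j, ball (a j x) e (a j y).
  by apply: filter_forall => j; apply: ca; exact: nbhsx_ballx.
apply: filterS => y xy; split=> // i j.
by rewrite !mxE; exact: xy.
Qed.

End RealContinuity.

Section ColimContinuity.
Variables (R : realType) (U : lmodType R).

Lemma continuous_linear_colim (V : lmodType R) (L : {linear U -> V}) :
  continuous (L : colim_space U -> colim_space V).
Proof.
apply/continuousP => A oA; rewrite colim_openE => m phi.
exact: (oA m (L \o phi : {linear _ -> _})).
Qed.

Lemma continuous_functional_colim (L : {linear U -> R^o}) :
  continuous (L : colim_space U -> R).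
Proof.
apply/continuousP => A oA; rewrite colim_openE => m phi.
pose f (v : 'rV[R]_m) : R := \sum_j v 0 j * L (phi (delta_mx 0 j)).
have cf : continuous f.
  apply: continuous_sum_real => j; apply: continuousM_real; last exact: cst_continuous.
  exact: coord_continuous.
rewrite (_ : phi @^-1` _ = f @^-1` A); first by move/continuousP: cf; exact.
rewrite /preimage; apply/funext => v /=; congr A; rewrite /f.
rewrite [in LHS](row_sum_delta v) !linear_sum; apply: eq_bigr => j _.
by rewrite !linearZ.
Qed.

Lemma continuous_combination (T : topologicalType) (I : finType)
    (a : I -> T -> R) (e : I -> U) :
  (forall i, continuous (a i)) ->
  continuous (fun x => \sum_i a i x *: e i : colim_space U).
Proof.
move=> ca.
pose f (v : 'rV[R]_#|I|) := \sum_i v 0 (enum_rank i) *: e i.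
have f_lin : linear f.
  move=> c v w; rewrite /f scaler_sumr -big_split; apply: eq_bigr => i _.
  by rewrite !mxE scalerDl scalerA.
pose L : {linear 'rV[R]_#|I| -> U} :=
  HB.pack f (GRing.isLinear.Build _ _ _ _ f f_lin).
have -> : (fun x => \sum_i a i x *: e i : colim_space U) =
    (L : _ -> colim_space U) \o (fun x => \row_j a (enum_val j) x).
  apply/funext => x /=; rewrite /f; apply: eq_bigr => i _.
  by rewrite mxE enum_rankK.
move=> x; apply: continuous_comp; last exact: linear_colim_continuous.
by apply: continuous_row => j; exact: ca.
Qed.

End ColimContinuity.

Section CompactImage.
Variables (R : realType) (G : finGroupType) (U : grep R G) (c : level_coords U).
Local Notation V := {ffun lc_index c -> R^o}.

(** Any norm on a level would do: it is only used to tell zero from nonzero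
    components by open conditions. *)
Definition level_norm (v : V) : R := \sum_s `|v s|.

Lemma level_norm_gt0 v : v != 0 -> 0 < level_norm v.
Proof.
move=> v0; rewrite lt0r sumr_ge0 // andbT; apply: contra_neq v0.
move=> /psumr_eq0P s0; apply/ffunP => s; rewrite ffunE; apply/normr0_eq0.
by apply: s0.
Qed.

Lemma level_coord_continuous n s :
  continuous ((fun u => lc c n u s) : colim_space U -> R).
Proof.
have lin : linear (fun u : U => lc c n u s : R^o).
  by move=> a u v; rewrite linearP !ffunE.
pose L : {linear U -> R^o} := HB.pack (fun u : U => lc c n u s : R^o)
  (GRing.isLinear.Build _ _ _ _ (fun u : U => lc c n u s : R^o) lin).
exact: (continuous_functional_colim (L := L)).
Qed.

Lemma level_norm_continuous n :
  continuous ((fun u => level_norm (lc c n u)) : colim_space U -> R).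
Proof.
apply: continuous_sum_real => s; apply: continuous_abs_real.
exact: level_coord_continuous.
Qed.

Lemma linear_levels_bounded m (phi : {linear 'rV[R]_m -> U}) :
  exists N, forall n v, (N <= n)%N -> lc c n (phi v) = 0.
Proof.
have [N NP] := choice (fun j : 'I_m => lc_finite c (phi (delta_mx 0 j))).
exists (\max_j N j) => n v Nn; rewrite (row_sum_delta v) !linear_sum big1 // => j _.
by rewrite !linearZ /= NP ?scaler0 // (leq_trans _ Nn) // leq_bigmax.
Qed.

(** The image of a linear map from R^m lies in finitely many levels, so that
    only finitely many of the conditions constrain its preimage. *)
Lemma open_tail_box (eps : nat -> R) M : (forall n, 0 < eps n) ->
  open ([set u | forall n, (M <= n)%N -> level_norm (lc c n u) < eps n]
    : set (colim_space U)).
Proof.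
move=> eps0; rewrite colim_openE => m phi.
have [N NP] := linear_levels_bounded phi.
have lev_open n : open ([set v | level_norm (lc c n (phi v)) < eps n] : set 'rV[R]_m).
  have /continuousP /(_ _ (@open_lt R (eps n))) := @level_norm_continuous n.
  by rewrite colim_openE => /(_ m phi).
rewrite openE => v /= vO.
have : \forall w \near v, forall n : 'I_N, (M <= n)%N ->
    level_norm (lc c n (phi w)) < eps n.
  apply: (@filter_forall _ _ (fun (n : 'I_N) w =>
    (M <= n)%N -> level_norm (lc c n (phi w)) < eps n) _ (nbhs_filter v)) => n.
  have [Mn|Mn] := boolP (M <= n)%N.
    have := lev_open n; rewrite openE => /(_ v (vO n Mn)).
    by apply: filterS => w wO _.
  by apply: filterE.
apply: filterS => w wO n Mn; have [nN|Nn] := ltnP n N.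
  exact: (wO (Ordinal nN)).
by rewrite NP // /level_norm big1 // => s _; rewrite ffunE normr0.
Qed.

(** If f is nonzero at level n for some k_n, let eps n be the norm of that
    component. The boxes bounded by eps from level M on are open, increase with M
    and cover U, so one of them contains f(K); but at a level n >= M where f is
    not identically zero, the point f(k_n) lies outside of this box. *)
Lemma compact_levels_bounded (K : topologicalType) (f : K -> colim_space U) :
  compact [set: K] -> continuous f ->
  exists N, forall k n, (N <= n)%N -> lc c n (f k) = 0.
Proof.
move=> cK cf.
have /choice [eps epsP] : forall n, exists e : R, 0 < e /\
    ((exists k, lc c n (f k) != 0) -> exists k, e <= level_norm (lc c n (f k))).
  move=> n; have [[k nz]|no] := pselect (exists k, lc c n (f k) != 0).
    exists (level_norm (lc c n (f k))); split; first exact: level_norm_gt0.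
    by move=> _; exists k.
  by exists 1; split.
pose O M : set (colim_space U) :=
  [set u | forall n, (M <= n)%N -> level_norm (lc c n u) < eps n].
have fO M : open (f @^-1` O M).
  by move/continuousP : cf; apply; apply: open_tail_box => n; have [] := epsP n.
have Omono M M' : (M <= M')%N -> O M `<=` O M'.
  by move=> MM' u uO n M'n; apply: uO; exact: leq_trans M'n.
move/compact_near_coveringP : cK => cK.
case: (cK _ _ (fun M k => O M (f k)) eventually_filter) => [k _|M _ MO].
  have [N NP] := lc_finite c (f k).
  exists (f @^-1` O N, [set M | (N <= M)%N]).
    split; last by exists N.
    apply: open_nbhs_nbhs; split => [|n Nn]; first exact: fO.
    rewrite NP // /level_norm big1 => [|s _]; last by rewrite ffunE normr0.
    by have [] := epsP n.
  by move=> [k' M] [/= k'O NM]; exact: Omono k'O.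
exists M => k n Mn; apply/eqP/negPn/negP => nz; have [_] := epsP n.
case; first by exists k.
move=> k'; apply/negP; rewrite -ltNge.
exact: (MO M (leqnn M) k' I).
Qed.

Lemma lc_basis_exists : exists e : nat * lc_index c -> U,
  forall p n, lc c n (e p) = if n == p.1 then [ffun s => (s == p.2)%:R] else 0.
Proof.
have /choice [e eP] : forall p : nat * lc_index c, exists u : U,
    forall n, lc c n u = if n == p.1 then [ffun s => (s == p.2)%:R] else 0.
  move=> p; apply: (@lc_surj _ _ _ c
    (fun n => if n == p.1 then [ffun s => (s == p.2)%:R] else 0) p.1.+1) => n pn.
  by rewrite gtn_eqF.
by exists e.
Qed.

(** A map from a compact space thus lands in a finite-dimensional subspace,
    where continuity is continuity of coordinates; the continuity of sums and
    multiples of maps to U is reduced to this. *)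
Lemma compact_expansion (K : topologicalType) (f : K -> colim_space U) :
  compact [set: K] -> continuous f ->
  exists (I : finType) (a : I -> K -> R) (e : I -> U),
    (forall i, continuous (a i)) /\ forall k, f k = \sum_i a i k *: e i.
Proof.
move=> cK cf; have [N NP] := compact_levels_bounded cK cf.
have [e eP] := lc_basis_exists.
exists ('I_N * lc_index c)%type,
  (fun (p : 'I_N * lc_index c) k => lc c (val p.1) (f k) p.2),
  (fun p : 'I_N * lc_index c => e (val p.1, p.2)); split.
  move=> p k; exact: (@continuous_comp K (colim_space U) R f
    (fun u => lc c (val p.1) u p.2) k (cf k) (@level_coord_continuous _ _ _)).
move=> k; apply/eqP; rewrite -subr_eq0; apply/eqP; apply: (@lc_eq0 _ _ _ c) => n.
rewrite linearB linear_sum /=; apply/eqP; rewrite subr_eq0; apply/eqP.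
apply/ffunP => s; rewrite sum_ffunE; have [nN|Nn] := ltnP n N; last first.
  rewrite NP // ffunE big1 // => -[i t] _; rewrite linearZ /= eP /= gtn_eqF.
    by rewrite scaler0 ffunE.
  exact: leq_trans Nn.
rewrite (bigD1 (Ordinal nN, s)) //= big1 ?addr0 => [|[i t] /= ne].
  by rewrite linearZ /= eP eqxx !ffunE eqxx [_ *: _]mulr1.
rewrite linearZ /= eP /=; case: eqP => [ni|_]; last by rewrite scaler0 ffunE.
rewrite !ffunE; case: eqP => [st|_]; last by rewrite scaler0.
by case/eqP: ne; congr pair => //; apply/val_inj.
Qed.

(** Continuity on a compactly generated space can be tested on maps from
    compact spaces, where both summands have finitely many coordinates. *)
Lemma continuousD_colim (T : topologicalType) (f h : T -> colim_space U) :
  compactly_generated T -> continuous f -> continuous h ->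
  continuous ((fun x => (f x : U) + h x) : T -> colim_space U).
Proof.
move=> cgT cf ch; apply/continuousP => A oA; apply: cgT => K p cK _ cp.
have [|I [a [e [ca aE]]]] := @compact_expansion K (f \o p) cK.
  by move=> x; apply: continuous_comp; [exact: cp|exact: cf].
have [|J [b [d [cb bE]]]] := @compact_expansion K (h \o p) cK.
  by move=> x; apply: continuous_comp; [exact: cp|exact: ch].
have := @continuous_combination R U K (I + J)%type
  (fun i => match i with inl i => a i | inr j => b j end)
  (fun i => match i with inl i => e i | inr j => d j end) _.
move=> /(_ (fun i => match i with inl i => ca i | inr j => cb j end)).
move=> /continuousP /(_ _ oA).
congr open; apply/funext => k; rewrite /preimage /=; congr A.
by rewrite big_sumType /= -aE -bE.
Qed.

Lemma continuousZ_colim (T : topologicalType) (a : T -> R) (f : T -> colim_space U) :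
  compactly_generated T -> continuous a -> continuous f ->
  continuous ((fun x => a x *: (f x : U)) : T -> colim_space U).
Proof.
move=> cgT ca cf; apply/continuousP => A oA; apply: cgT => K p cK _ cp.
have [|I [b [e [cb bE]]]] := @compact_expansion K (f \o p) cK.
  by move=> x; apply: continuous_comp; [exact: cp|exact: cf].
have /continuousP /(_ _ oA) := @continuous_combination R U K I
  (fun i k => a (p k) * b i k) e (fun i => continuousM_real (fun x =>
    @continuous_comp _ _ _ p a x (cp x) (ca (p x))) (cb i)).
congr open; apply/funext => k; rewrite /preimage /=; congr A.
have /= -> := bE k; rewrite scaler_sumr; apply: eq_bigr => i _.
by rewrite scalerA.
Qed.

Lemma continuous_sum_colim (T : topologicalType) (I : Type) (r : seq I)
    (f : I -> T -> colim_space U) :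
  compactly_generated T -> (forall i, continuous (f i)) ->
  continuous ((fun x => \sum_(i <- r) (f i x : U)) : T -> colim_space U).
Proof.
move=> cgT cf; elim: r => [|i r IHr].
  under [X in continuous X]eq_fun do rewrite big_nil.
  exact: cst_continuous.
under [X in continuous X]eq_fun do rewrite big_cons.
exact: continuousD_colim.
Qed.

End CompactImage.

Lemma continuous_from_kify (S T : topologicalType) (f : S -> T) :
  continuous f -> continuous (f : kify S -> T).
Proof.
move=> cf x; apply: (@continuous_comp (kify S) S T id f); last exact: cf.
exact: kify_id_continuous.
Qed.

(** * Any two isovariant maps to the universe are homotopic *)

Section Homotopy.
Variables (R : realType) (G : finGroupType) (U : grep R G) (c : level_coords U).

Lemma grep_actD g (u v : U) : grep_act g (u + v) = grep_act g u + grep_act g v.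
Proof. exact: linearD. Qed.

Lemma grep_actZ g (a : R) (u : U) : grep_act g (a *: u) = a *: grep_act g u.
Proof. exact: linearZ. Qed.

Lemma lc_act0 g : lc_act (l := c) g 0 = 0.
Proof. by rewrite -(linear0 (lc c 0)) -lcJ linear0. Qed.

Lemma lc_inj u v : (forall n, lc c n u = lc c n v) -> u = v.
Proof.
move=> uv; apply/eqP; rewrite -subr_eq0; apply/eqP; apply: (@lc_eq0 _ _ _ c) => n.
by rewrite linearB uv subrr.
Qed.

(** The component of L u at level n is the component of u at level r n. The
    bound makes finitely many levels of u contribute to finitely many levels of
    L u; its shape is the one needed for the levels 2m+1 and 2m+2. *)
Lemma level_shift (r : nat -> option nat) :
  (forall n m, r n = Some m -> (n <= m.+1.*2)%N) ->
  exists L : {linear U -> U},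
    (forall u n, lc c n (L u) = if r n is Some m then lc c m u else 0) /\
    forall g u, L (grep_act g u) = grep_act g (L u).
Proof.
move=> r_le.
have /choice [L LE] : forall u : U, exists v : U,
    forall n, lc c n v = if r n is Some m then lc c m u else 0.
  move=> u; have [N NP] := lc_finite c u.
  apply: (@lc_surj _ _ _ c (fun n => if r n is Some m then lc c m u else 0)
    N.*2.+1) => n nN.
  case rn: (r n) => [m|//]; apply: NP; rewrite -ltnS -ltn_double.
  exact: leq_trans (r_le _ _ rn).
have L_lin : linear L.
  move=> a u v; apply: lc_inj => n; rewrite linearP !LE.
  by case: (r n) => [m|]; rewrite ?linearP // scaler0 addr0.
pose L' : {linear U -> U} := HB.pack L (GRing.isLinear.Build _ _ _ _ L L_lin).
exists L'; split => // g u; rewrite -[LHS]/(L _) -[L' u]/(L u).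
apply: lc_inj => n; rewrite lcJ !LE.
by case: (r n) => [m|]; rewrite ?lcJ ?lc_act0.
Qed.

(** Level N of w moves to level 2N+1 under J0, and level N of z to level 2N+2
    under J1. If w and z vanish above N, then at these two levels the relation
    reads d w_N = 0 and d z_N = 0; a descending induction on N concludes. *)
Lemma interleaving : exists J0 J1 : {linear U -> U},
  [/\ forall g u, J0 (grep_act g u) = grep_act g (J0 u),
      forall g u, J1 (grep_act g u) = grep_act g (J1 u) &
      forall (a b d : R) (w z : U), d != 0 ->
        a *: w + b *: z + d *: (J0 w + J1 z) = 0 -> w = 0 /\ z = 0].
Proof.
have [n m|J0 [J0E J0J]] :=
    @level_shift (fun n => if odd n then Some n./2 else None).
  case: ifP => // on [<-]; rewrite doubleS -{1}(odd_double_half n) on.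
  by rewrite add1n ltnS leqW.
have [n m|J1 [J1E J1J]] :=
    @level_shift (fun n => if odd n || (n == 0)%N then None else Some n./2.-1).
  case: ifP => // /norP [on n0] [<-]; rewrite prednK.
    by rewrite -{1}(odd_double_half n) (negbTE on).
  by rewrite half_gt0; case: n n0 on => [|[|n]].
exists J0, J1; split => // a b d w z d0 E.
have lev n : a *: lc c n w + b *: lc c n z +
    d *: (lc c n (J0 w) + lc c n (J1 z)) = 0.
  by rewrite -!(linearZ, linearD) E linear0.
have solve (v : {ffun lc_index c -> R^o}) : d *: v = 0 -> v = 0.
  by move/eqP; rewrite scaler_eq0 (negbTE d0) => /eqP.
pose P N := forall n, (N <= n)%N -> lc c n w = 0 /\ lc c n z = 0.
have PS N : P N.+1 -> P N.
  move=> PN n; rewrite leq_eqVlt => /orP[/eqP <-{n}|]; last exact: PN.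
  have [|w1 z1] := PN N.*2.+1; first by rewrite ltnS -addnn leq_addr.
  have [|w2 z2] := PN N.*2.+2; first by rewrite ltnS leqW // -addnn leq_addr.
  split; apply: solve.
    have := lev N.*2.+1; rewrite w1 z1 !scaler0 !add0r J0E J1E /= odd_double /=.
    by rewrite uphalf_double addr0.
  have := lev N.*2.+2; rewrite w2 z2 !scaler0 !add0r J0E J1E /= odd_double /=.
  by rewrite doubleK add0r.
have P0 : P 0%N.
  have [[N NP] [M MP]] := (lc_finite c w, lc_finite c z).
  have : P (N + M)%N.
    move=> n Nn; rewrite NP ?MP //; apply: leq_trans Nn.
      exact: leq_addl.
    exact: leq_addr.
  by elim: (N + M)%N => // k IH /PS.
by split; apply: (@lc_eq0 _ _ _ c) => n; have [] := P0 n (leq0n n).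
Qed.

(** If g fixes h(x, t) with 0 < t < 1, then [interleaving] applied to
    w = g f0(x) - f0(x) and z = g f1(x) - f1(x) shows that g fixes f0(x), and
    hence x. *)
Lemma isovariant_maps_homotopic (X : gspace G) (f0 f1 : X -> grep_gspace U) :
  isovariant f0 -> isovariant f1 -> isovariant_homotopic R f0 f1.
Proof.
move=> [cf0 ef0 if0] [cf1 ef1 if1].
have [J0 [J1 [J0J J1J Jinj]]] := interleaving.
pose P : gspace G := prod_gspace X (trivial_gspace G (unit_interval R)).
pose t (p : P) : R := set_val (p.2 : unit_interval R).
pose h (p : P) : grep_gspace U :=
  ((1 - t p) *: (f0 p.1 : U) + t p *: (f1 p.1 : U) +
   (t p * (1 - t p)) *: (J0 (f0 p.1) + J1 (f1 p.1)) : U).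
have cg : compactly_generated P by exact: gspace_cg.
have ct : continuous t.
  apply: (@continuous_from_kify (X * kify (unit_interval R))%type R).
  move=> p; apply: (@continuous_comp _ (kify (unit_interval R)) _ snd
    (fun s => set_val (s : unit_interval R))); first exact: cvg_snd.
  exact: (continuous_from_kify (@initial_continuous _ _ _)).
have c1t : continuous (fun p => 1 - t p).
  apply: (@continuousD_real R P (fun=> 1) (fun p => - t p)).
    exact: cst_continuous.
  by move=> p; apply: (@continuousN _ R^o _ t); exact: ct.
have cfst : continuous (fun p : P => p.1 : X).
  apply: (@continuous_from_kify (X * kify (unit_interval R))%type X) => p.
  exact: cvg_fst.
have cf0' : continuous (fun p : P => f0 p.1).
  by move=> p; apply: (@continuous_comp _ _ _ _ f0); [exact: cfst|exact: cf0].
have cf1' : continuous (fun p : P => f1 p.1).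
  by move=> p; apply: (@continuous_comp _ _ _ _ f1); [exact: cfst|exact: cf1].
have cL (L : {linear U -> U}) (f : P -> grep_gspace U) : continuous f ->
    continuous ((fun p => L (f p)) : P -> colim_space U).
  move=> cf p; apply: (@continuous_comp _ _ _ f
    (L : colim_space U -> colim_space U)); first exact: cf.
  exact: continuous_linear_colim.
have eh : equivariant h.
  move=> g p; rewrite /h /= ef0 ef1 /= J0J J1J.
  by rewrite !grep_actD !grep_actZ grep_actD.
exists h; split.
- split=> //.
    apply: (continuousD_colim c cg); last first.
      apply: (continuousZ_colim c cg); first exact: continuousM_real.
      by apply: (continuousD_colim c cg); exact: cL.
    by apply: (continuousD_colim c cg); apply: (continuousZ_colim c cg).
  move=> p; apply/seteqP; split => g; rewrite /isotropy /=.
    by move=> gp; rewrite -[RHS](congr1 h gp); exact/esym/eh.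
  move=> gh.
  have fixX (f : X -> grep_gspace U) : (forall x, isotropy x = isotropy (f x)) ->
      grep_act g (f p.1) = f p.1 -> prod_act g p = p.
    move=> fI gf; have : isotropy p.1 g by rewrite fI.
    by rewrite /isotropy /prod_act /=; case: (p) => x s /= ->.
  have [t0|t0] := eqVneq (t p) 0.
    apply: (fixX f0) => //; move: gh.
    by rewrite /h t0 subr0 mul0r !scale0r !addr0 scale1r.
  have [t1|t1] := eqVneq (1 - t p) 0.
    have tp : t p = 1 by apply/esym/eqP; rewrite -subr_eq0 t1.
    apply: (fixX f1) => //; move: gh.
    by rewrite /h tp subrr mulr0 !scale0r addr0 add0r scale1r.
  apply: (fixX f0) => //; apply/eqP; rewrite -subr_eq0; apply/eqP.
  suff : (1 - t p) *: (grep_act g (f0 p.1) - f0 p.1 : U) +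
      t p *: (grep_act g (f1 p.1) - f1 p.1 : U) + (t p * (1 - t p)) *:
      (J0 (grep_act g (f0 p.1) - f0 p.1) + J1 (grep_act g (f1 p.1) - f1 p.1)) = 0.
    by move/Jinj => []; rewrite ?mulf_neq0.
  (* the left-hand side is g (h p) - h p, expanded *)
  rewrite (linearB J0) (linearB J1) /= J0J J1J.
  rewrite (addrACA (grep_act g (J0 _))) -opprD !scalerBr.
  rewrite (addrACA ((1 - t p) *: _)) -opprD addrACA -opprD.
  by rewrite -grep_actD -!grep_actZ -!grep_actD gh subrr.
- by move=> x s s0; rewrite /h /t /= s0 subr0 mul0r !scale0r !addr0 scale1r.
- by move=> x s s1; rewrite /h /t /= s1 subrr mulr0 !scale0r addr0 add0r scale1r.
Qed.

End Homotopy.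

(** * Compact Hausdorff spaces and Tietze extension *)

Definition compact_hausdorff (T : topologicalType) : Prop :=
  compact [set: T] /\ hausdorff_space T.

Section CompactHausdorff.

Lemma compact_surjection (S T : topologicalType) (f : S -> T) :
  continuous f -> (forall y, exists x, f x = y) -> compact [set: S] ->
  compact [set: T].
Proof.
move=> cf sf cS; suff <- : f @` [set: S] = [set: T].
  by apply: continuous_compact => //; exact: continuous_subspaceT.
by apply/seteqP; split => // y _; have [x <-] := sf y; exists x.
Qed.

Lemma hausdorff_separating (J : Type) (S T : topologicalType) (f : J -> S -> T) :
  (forall j, continuous (f j)) -> hausdorff_space T ->
  (forall x y, (forall j, f j x = f j y) -> x = y) -> hausdorff_space S.
Proof.
move=> cf hT f_inj p q pq; apply: f_inj => j; apply: hT => B C pB qC.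
by have [x [Bx Cx]] := pq _ _ (cf j p B pB) (cf j q C qC); exists (f j x).
Qed.

(** The k-ification has the same maps from compact Hausdorff spaces, so the
    identity of T is continuous into it. *)
Lemma compact_hausdorff_kify (T : topologicalType) :
  compact_hausdorff T -> compact_hausdorff (kify T).
Proof.
move=> [cT hT]; split.
  apply: (@compact_surjection T (kify T) id) => //; last by move=> y; exists y.
  by apply: (@continuous_to_kify T T id) => // x; exact: cvg_id.
apply: (@hausdorff_separating unit (kify T) T (fun _ => id)) => //.
  by move=> _; exact: kify_id_continuous.
by move=> x y /(_ tt).
Qed.

Lemma compact_hausdorff_prod (S T : topologicalType) :
  compact_hausdorff S -> compact_hausdorff T -> compact_hausdorff (S * T)%type.
Proof.
move=> [cS hS] [cT hT]; split; first by rewrite -setXTT; exact: compact_setX.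
move=> p q pq.
rewrite (surjective_pairing p) (surjective_pairing q); congr pair.
  apply: hS => B C pB qC.
  by have [x [Bx Cx]] := pq _ _ (cvg_fst pB) (cvg_fst qC); exists x.1.
apply: hT => B C pB qC.
by have [x [Bx Cx]] := pq _ _ (cvg_snd pB) (cvg_snd qC); exists x.2.
Qed.

Lemma compact_hausdorff_closed (T : topologicalType) (A : set T) :
  compact_hausdorff T -> closed A -> compact_hausdorff A.
Proof.
move=> [cT hT] clA; split; last exact: set_type_hausdorff.
by apply: set_type_compact; exact: subclosed_compact cT _.
Qed.

Lemma compact_sum_space (S T : topologicalType) :
  compact [set: S] -> compact [set: T] -> compact [set: sum_space S T].
Proof.
move=> cS cT.
have -> : [set: sum_space S T] = ((inl : S -> sum_space S T) @` setT) `|`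
    ((inr : T -> sum_space S T) @` setT).
  apply/seteqP; split => // -[x|y] _; [by left; exists x|by right; exists y].
apply: compactU; apply: continuous_compact => //; apply: continuous_subspaceT;
  by apply/continuousP => A [].
Qed.

(** The map induced on a quotient is written as F composed with the choice of
    representatives. *)
Section QuotientLift.
Variables (T Z : topologicalType) (r : T -> T -> Prop) (F : T -> Z).
Hypothesis rF : forall x y, r x y -> F x = F y.

Lemma quot_liftE x : F (repr (qpi r x)) = F x.
Proof.
have : clos_refl_sym_trans T r (repr (qpi r x)) x.
  by apply/qpi_eqP; rewrite /qpi reprK.
move: (repr _) => y; elim=> [a b ab|//|a b _ -> //|a b d _ -> _ -> //].
exact: rF.
Qed.

Lemma quot_lift_continuous :
  continuous F -> continuous (fun q : quot_space r => F (repr q)).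
Proof.
move=> cF; apply/quotient_continuous.
have -> : (fun q : quot_space r => F (repr q)) \o
    \pi_(quotient_topology _) = F :> (T -> Z).
  by apply/funext => x /=; exact: quot_liftE.
exact: cF.
Qed.

End QuotientLift.

(** A quotient of a compact space need not be Hausdorff; it is as soon as maps
    to a Hausdorff space that respect the relation separate the classes. *)
Lemma compact_hausdorff_quot (T Z : topologicalType) (r : T -> T -> Prop)
    (J : Type) (F : J -> T -> Z) :
  compact [set: T] -> hausdorff_space Z -> (forall j, continuous (F j)) ->
  (forall j x y, r x y -> F j x = F j y) ->
  (forall x y, (forall j, F j x = F j y) -> clos_refl_sym_trans T r x y) ->
  compact_hausdorff (quot_space r).
Proof.
move=> cT hZ cF rF Fr.
have surj (q : quot_space r) : exists x, qpi r x = q.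
  by exists (repr q); rewrite /qpi reprK.
split.
  by apply: (@compact_surjection T _ (qpi r)) => //; exact: pi_continuous.
apply: (@hausdorff_separating J (quot_space r) Z (fun j q => F j (repr q))) => //.
  by move=> j; apply: quot_lift_continuous => // x y; exact: rF.
move=> p q; have [[x <-] [y <-]] := (surj p, surj q) => xy.
apply/qpi_eqP/Fr => j; have := xy j.
by rewrite !(quot_liftE (rF j)).
Qed.

(** An injective continuous map from a compact space to a Hausdorff space is a
    closed embedding, and a compact Hausdorff space is normal. *)
Lemma tietze_embedding (R : realType) (A B : topologicalType) (i : A -> B)
    (a : A -> R) :
  compact [set: A] -> compact_hausdorff B -> continuous i -> injective i ->
  continuous a -> exists b : B -> R, continuous b /\ forall x, b (i x) = a x.
Proof.
move=> cA [cB hB] ci i_inj ca.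
have closed_im (C : set A) : closed C -> closed (i @` C).
  move=> clC; apply: compact_closed => //; apply: continuous_compact.
    exact: continuous_subspaceT.
  exact: subclosed_compact cA _.
have /choice [f fE] : forall y : B, exists z : R, forall x, i x = y -> z = a x.
  move=> y; have [[x <-]|no] := pselect (exists x, i x = y).
    by exists (a x) => x' /i_inj ->.
  by exists 0 => x xy; case: no; exists x.
have fi x : f (i x) = a x by exact: fE.
have [M [_ MA]] : bounded_set (a @` [set: A]).
  apply: compact_bounded; apply: continuous_compact => //.
  exact: continuous_subspaceT.
have [||y [x _ <-]|b [bE cb _]] := @continuous_bounded_extension B R
    (compact_normal hB cB) (range i) (closed_im _ closedT) f (`|M| + 1).
- by rewrite ltr_pwDr.
- apply/continuous_closedP => C clC; apply/closed_subspaceP.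
  exists (i @` (a @^-1` C)).
    by apply: closed_im; move/continuous_closedP : ca; exact.
  apply/seteqP; split => y [].
    move=> [x Cx <-] _; split; last by exists x.
    by change (C (f (i x))); rewrite fi.
  move=> fC [x _ xy]; rewrite -xy in fC *; split; exists x => //.
  by change (C (a x)); rewrite -fi; exact: fC.
- by rewrite fi; apply: MA; [rewrite ltr_pwDr // ler_norm|exists x].
exists b; split => // x; rewrite -fi -bE //.
by apply/mem_set; exists x.
Qed.

End CompactHausdorff.

(** * Extending isovariant maps *)

Section IsovariantExtension.
Variables (R : realType) (G : finGroupType) (U : grep R G) (c : level_coords U).

(** The finitely many coordinates of u are extended separately; the average of
    the conjugates g v0 g^-1 of the resulting map v0 still extends u, because u
    is equivariant. *)
Lemma equivariant_extension (A B : gspace G) (i : A -> B)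
    (u : A -> grep_gspace U) :
  compact [set: A] -> compact_hausdorff B -> continuous i -> equivariant i ->
  injective i -> continuous u -> equivariant u ->
  exists v : B -> grep_gspace U,
    [/\ continuous v, equivariant v & forall x, v (i x) = u x].
Proof.
move=> cA chB ci ei i_inj cu eu.
have [S [a [e [ca aE]]]] := compact_expansion c cA cu.
have /choice [b bP] : forall s : S, exists b : B -> R,
    continuous b /\ forall x, b (i x) = a s x.
  by move=> s; exact: tietze_embedding.
pose v0 (y : B) : U := \sum_s b s y *: e s.
pose v (y : B) : grep_gspace U :=
  #|G|%:R^-1 *: \sum_(g : G) grep_act g (v0 (gact g^-1%g y)) : U.
exists v; split.
- apply: (@continuousZ_colim _ _ _ c B (fun=> #|G|%:R^-1)
    (fun y => \sum_(g : G) grep_act g (v0 (gact g^-1%g y))) (@gspace_cg G B)).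
    exact: cst_continuous.
  apply: (@continuous_sum_colim _ _ _ c B G _
    (fun g y => grep_act g (v0 (gact g^-1%g y))) (@gspace_cg G B)) => g y.
  apply: (@continuous_comp _ _ _ (fun y => v0 (gact g^-1%g y) : colim_space U)
    (grep_act g : colim_space U -> colim_space U)).
    apply: (@continuous_comp _ _ _ (gact g^-1%g) (v0 : B -> colim_space U)).
      exact: gact_continuous.
    by apply: continuous_combination => s; have [] := bP s.
  exact: grep_act_continuous.
- move=> h y; rewrite /v /= grep_actZ (linear_sum (grep_act h)) /=; congr (_ *: _).
  rewrite (reindex_inj (mulgI h)) /=; apply: eq_bigr => g _.
  by rewrite grep_actM invMg gactM -(gactM h^-1) mulVg gact1.
- move=> x; rewrite /v (eq_bigr (fun=> u x : U)) => [|g _].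
    rewrite sumr_const -[(u x : U) *+ _]scaler_nat scalerA mulVf ?scale1r //.
    by rewrite pnatr_eq0 -lt0n; apply/card_gt0P; exists 1%g.
  have -> : v0 (gact g^-1%g (i x)) = u (gact g^-1%g x).
    rewrite -ei aE /v0; apply: eq_bigr => s _.
    by have [_ ->] := bP s.
  by rewrite eu /= -grep_actM mulgV grep_act1.
Qed.

(** The components of v and w lie in disjoint sets of levels, so an element
    fixing v(y) + w(y) fixes w(y), which off the image of i puts it in the
    isotropy group of y. On the image of i the sum is u. *)
Lemma isovariant_extension (A B : gspace G) (i : A -> B)
    (u : A -> grep_gspace U) :
  compact [set: A] -> compact_hausdorff B -> isovariant i -> injective i ->
  isovariant u ->
  (forall N, exists w : B -> grep_gspace U,
     [/\ continuous w, equivariant w,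
         forall y n, (n < N)%N -> lc c n (w y) = 0,
         forall x, w (i x) = 0 :> U &
         forall y, (exists x, i x = y) \/ isotropy (w y) `<=` isotropy y]) ->
  exists h : B -> grep_gspace U, isovariant h /\ forall x, h (i x) = u x.
Proof.
move=> cA chB [ci ei iI] i_inj [cu eu uI] wP.
have [v [cv ev vi]] := equivariant_extension cA chB ci ei i_inj cu eu.
have [N NP] := compact_levels_bounded c chB.1 cv.
have [w [cw ew wN wi wI]] := wP N.
pose h (y : B) : grep_gspace U := (v y : U) + w y.
have hi x : h (i x) = u x by rewrite /h wi addr0 vi.
have eh : equivariant h by move=> g y; rewrite /h ev ew /= grep_actD.
exists h; split => //; split => //.
  exact: (continuousD_colim c (@gspace_cg G B)).
move=> y; apply/seteqP; split => g; rewrite /isotropy /=.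
  by move=> gy; rewrite -[RHS](congr1 h gy); exact/esym/eh.
move=> gh; case: (wI y) => [[x xy]|]; first last.
  apply; rewrite /isotropy /=; apply: (lc_inj (c := c)) => n; rewrite lcJ.
  have [nN|Nn] := ltnP n N; first by rewrite !wN // lc_act0.
  have hw : lc c n (h y) = lc c n (w y) by rewrite /h linearD NP // add0r.
  by rewrite -hw -lcJ gh.
have : isotropy (u x) g by rewrite /isotropy /= -hi xy.
by rewrite -uI iI xy.
Qed.

End IsovariantExtension.

(** * Discs, spheres and linking simplices are compact Hausdorff *)

Section Compactness.
Variables (R : realType) (G : finGroupType).

Lemma simplex_compact n : compact (simplex R n).
Proof.
have -> : simplex R n = [set t : 'rV[R]_n.+1 | forall i, `[0, 1]%classic (t ord0 i)] `&`
    ((fun t : 'rV[R]_n.+1 => \sum_i t 0 i) @^-1` [set 1]).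
  apply/seteqP; split => t /=.
    move=> [t0 t1]; split => // i; rewrite in_itv /= t0 /= -t1.
    by rewrite (bigD1 i) //= lerDl sumr_ge0.
  by move=> [tb t1]; split => // i; have := tb i; rewrite in_itv /= => /andP[].
apply: compact_closedI.
  by apply: (@rV_compact R _ (fun=> `[0 : R, 1]%classic)) => i; exact: segment_compact.
have /continuous_closedP : continuous (fun t : 'rV[R]_n.+1 => \sum_i t 0 i).
  by apply: continuous_sum_real => i; exact: coord_continuous.
by apply; exact: closed_eq.
Qed.

Lemma sum_sqr_continuous k :
  continuous (fun x : 'rV[R]_k => \sum_i x 0 i ^+ 2).
Proof.
apply: continuous_sum_real => i.
by apply: continuousM_real; exact: coord_continuous.
Qed.

Lemma disc_compact k : compact (disc R k).
Proof.
have -> : disc R k = [set x : 'rV[R]_k | forall i, `[-1, 1]%classic (x ord0 i)] `&`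
    ((fun x : 'rV[R]_k => \sum_i x 0 i ^+ 2) @^-1` [set s | s <= 1]).
  apply/seteqP; split => x /=; last by case.
  move=> x1; split => // i; rewrite in_itv /= -ler_norml.
  rewrite -(@expr_le1 _ 2) // -normrX ger0_norm ?sqr_ge0 // (le_trans _ x1) //.
  by rewrite (bigD1 i) //= lerDl sumr_ge0 // => j _; exact: sqr_ge0.
apply: compact_closedI.
  by apply: (@rV_compact R _ (fun=> `[-1 : R, 1]%classic)) => i; exact: segment_compact.
move/continuous_closedP : (@sum_sqr_continuous k); apply; exact: closed_le.
Qed.

Lemma compact_hausdorff_set n (A : set 'rV[R]_n) :
  compact A -> compact_hausdorff A.
Proof.
move=> cA; split; first exact: set_type_compact.
by apply: set_type_hausdorff; exact: norm_hausdorff.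
Qed.

Lemma disc_gspace_compact_hausdorff k : compact_hausdorff (disc_gspace R G k).
Proof.
by apply: compact_hausdorff_kify; apply: compact_hausdorff_set; exact: disc_compact.
Qed.

(** This function is zero exactly on the sphere; it serves both to see that
    the sphere is closed and as a factor of the map added off the boundary. *)
Definition disc_defect k (x : disc_gspace R G k) : R :=
  1 - \sum_i (set_val (x : disc R k) : 'rV[R]_k) 0 i ^+ 2.

Lemma disc_defect_continuous k : continuous (@disc_defect k).
Proof.
apply: (@continuous_from_kify (disc R k) R) => x.
apply: (@continuous_comp _ _ _ set_val (fun x : 'rV[R]_k => 1 - \sum_i x 0 i ^+ 2)).
  exact: initial_continuous.
apply: continuousB; [exact: cst_continuous|exact: sum_sqr_continuous].
Qed.

Lemma sphereE k : @sphere R G k = @disc_defect k @^-1` [set 0].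
Proof.
apply/seteqP; split => x; rewrite /sphere /disc_defect /=.
  by move=> ->; rewrite subrr.
by move/eqP; rewrite subr_eq0 => /eqP.
Qed.

Lemma sphere_gspace_compact_hausdorff k : compact_hausdorff (sphere_gspace R G k).
Proof.
apply: compact_hausdorff_kify; apply: compact_hausdorff_closed.
  exact: disc_gspace_compact_hausdorff.
rewrite sphereE; move/continuous_closedP : (@disc_defect_continuous k); apply.
exact: closed_eq.
Qed.

Variables (n : nat) (H : chain G n).

Local Notation LT := (link_total R G n).
Definition bary (i : 'I_n.+1) (p : LT) : R := (set_val p.2 : 'rV[R]_n.+1) 0 i.

Lemma bary_continuous i : continuous (bary i).
Proof.
move=> p; apply: (@continuous_comp _ _ _ snd
  (fun t : simplex R n => (set_val t : 'rV[R]_n.+1) 0 i)); first exact: cvg_snd.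
apply: (@continuous_comp _ _ _ set_val (fun t : 'rV[R]_n.+1 => t 0 i)).
  exact: initial_continuous.
exact: coord_continuous.
Qed.

Lemma group_coord_continuous (f : G -> R) : continuous (fun p : LT => f p.1).
Proof.
have cf : continuous (f : discrete_topology G -> R).
  by apply/continuousP => U _; exact: discrete_open.
move=> p; apply: (@continuous_comp _ (discrete_topology G) _ fst f); last exact: cf.
exact: cvg_fst.
Qed.

Lemma link_total_compact : compact [set: LT].
Proof.
rewrite -setXTT; apply: compact_setX.
  by apply: finite_compact; exact: finite_finset.
exact: set_type_compact (@simplex_compact n).
Qed.

(** Barycentric coordinates add up to 1, so one of them is nonzero. *)
Lemma last_vertex (p : LT) : exists m : 'I_n.+1,
  bary m p != 0 /\ forall j : 'I_n.+1, (m < j)%N -> bary j p = 0.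
Proof.
have [i0 i0P] : exists i, bary i p != 0.
  apply: contrapT => no; have [_ /eqP] := set_valP p.2.
  rewrite big1 ?(eq_sym 0) ?oner_eq0 // => i _.
  by apply/eqP/negPn/negP => nz; apply: no; exists i.
have [m mP mmax] :=
  @arg_maxnP _ i0 (fun i => bary i p != 0) (fun i : 'I_n.+1 => i : nat) i0P.
exists m; split => // j mj.
by apply/eqP/negPn/negP => /mmax /=; rewrite /geq /= leqNgt mj.
Qed.

(** For j = (i, a): the coordinate t_i if a is in the coset g H_(n-i), and 0
    otherwise. At [g, t], the cosets g H_(n-i) with t_i nonzero are well
    defined, hence so is this function on the linking simplex; together these
    functions embed the linking simplex in a Euclidean space. *)
Definition link_weight (j : 'I_n.+1 * G) (p : LT) : R :=
  bary j.1 p * (j.2 \in p.1 *: H (rev_ord j.1))%g%:R.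

Lemma chain_mono (i j : 'I_n.+1) : (i <= j)%N -> H i \subset H j.
Proof.
rewrite leq_eqVlt => /orP[/eqP/val_inj -> //|ij].
exact: proper_sub (chain_strict H ij).
Qed.

(** The relation compares cosets at the last nonzero coordinate m. For i <= m
    the group H_(n-i) contains H_(n-m), so the cosets of H_(n-i) agree too. *)
Lemma link_rel_cosets p q : link_rel H p q ->
  p.2 = q.2 /\ forall i, bary i p != 0 ->
    (p.1 *: H (rev_ord i) = q.1 *: H (rev_ord i))%g.
Proof.
case: p q => [a x] [b y] [/= <- [m [tm tj]]]; rewrite !lcosetE => ab; split => // i ti.
have im : (i <= m)%N by rewrite leqNgt; apply: contra_neqN ti => /tj.
apply/lcoset_eqP; move/lcoset_eqP : ab; rewrite !mem_lcoset.
by apply: (fintype.subsetP (chain_mono _)); rewrite /= leq_sub2l.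
Qed.

Lemma link_weight_rel j p q : link_rel H p q -> link_weight j p = link_weight j q.
Proof.
move=> /link_rel_cosets [pq H_]; rewrite /link_weight.
have -> : bary j.1 q = bary j.1 p by rewrite /bary pq.
have [->|nz] := eqVneq (bary j.1 p) 0; first by rewrite !mul0r.
by rewrite H_.
Qed.

(** If t_i is nonzero, the weight of index (i, g) at [g, t] is t_i; its being
    equal to that at [g', t'] forces t'_i = t_i and g to be in g' H_(n-i). *)
Lemma link_weight_separates p q :
  (forall j, link_weight j p = link_weight j q) -> link_rel H p q.
Proof.
move=> E.
have b_eq p' q' i : (forall j, link_weight j p' = link_weight j q') ->
    bary i p' != 0 -> bary i q' = bary i p' /\ (p'.1 \in q'.1 *: H (rev_ord i))%g.
  move=> E' nz; have := E' (i, p'.1); rewrite /link_weight /= lcoset_refl mulr1.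
  by case: (_ \in _) => [|/eqP]; [rewrite mulr1|rewrite mulr0 (negbTE nz)].
have pq i : bary i p = bary i q.
  have [p0|/(b_eq _ _ _ E) [-> //]] := eqVneq (bary i p) 0.
  have [q0|/(b_eq _ _ _ (fun j => esym (E j))) [-> //]] := eqVneq (bary i q) 0.
  by rewrite p0 q0.
split; first by apply/val_inj/rowP => i; exact: pq.
have [m [m0 mj]] := last_vertex p; exists m; split => //.
rewrite !lcosetE; apply/lcoset_eqP.
by have [_] := b_eq _ _ _ E m0.
Qed.

Lemma link_weight_continuous j : continuous (link_weight j).
Proof.
have := @group_coord_continuous (fun a => (j.2 \in a *: H (rev_ord j.1))%g%:R).
exact: (continuousM_real (@bary_continuous _)).
Qed.

Lemma linking_simplex_compact_hausdorff : compact_hausdorff (linking_simplex R H).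
Proof.
apply: compact_hausdorff_kify.
apply: (@compact_hausdorff_quot _ R _ _ link_weight link_total_compact).
- exact: Rhausdorff.
- exact: link_weight_continuous.
- by move=> j p q; exact: link_weight_rel.
- by move=> p q E; apply: rst_step; exact: link_weight_separates.
Qed.

End Compactness.

(** * The boundary of a linking simplex and the pushout-products *)

Section GeneratorSpaces.
Variables (R : realType) (G : finGroupType) (n : nat) (H : chain G n).
Local Notation LT := (link_total R G n).
Local Notation L := (linking_simplex R H).

Definition bary_prod (p : LT) : R := \prod_i bary i p.

Lemma bary_prod_continuous : continuous bary_prod.
Proof. by apply: continuous_prod_real => i; exact: bary_continuous. Qed.

Lemma bary_prod_eq0 p : bary_prod p = 0 <-> exists i, bary i p = 0.
Proof.
split=> [/eqP|[i pi]]; last by rewrite /bary_prod (bigD1 i) //= pi mul0r.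
by move/prodf_eq0 => [i _ /eqP pi]; exists i.
Qed.

(** The product of the barycentric coordinates, which vanishes exactly on the
    boundary ([link_boundaryE]). *)
Definition link_depth (l : L) : R :=
  bary_prod (repr (l : quot_space (@link_rel R G n H))).

Lemma link_depth_qpi p : link_depth (qpi _ p) = bary_prod p.
Proof.
apply: (@quot_liftE LT R (@link_rel R G n H) bary_prod) => x y [xy _].
by rewrite /bary_prod /bary xy.
Qed.

Lemma link_depth_continuous : continuous link_depth.
Proof.
apply: (@continuous_from_kify (quot_space (@link_rel R G n H)) R).
apply: (@quot_lift_continuous LT R (@link_rel R G n H) bary_prod).
  by move=> x y [xy _]; rewrite /bary_prod /bary xy.
exact: bary_prod_continuous.
Qed.

Lemma link_boundaryE : @link_boundary R G n H = link_depth @^-1` [set 0].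
Proof.
apply/seteqP; split => l; rewrite /link_boundary /=.
  by move=> [p [i pi] <-]; rewrite link_depth_qpi; apply/bary_prod_eq0; exists i.
move/bary_prod_eq0 => [i pi]; exists (repr (l : quot_space (@link_rel R G n H))).
  by exists i.
by rewrite /qpi reprK.
Qed.

Lemma boundary_simplex_compact_hausdorff : compact_hausdorff (boundary_simplex R H).
Proof.
apply: compact_hausdorff_kify; apply: compact_hausdorff_closed.
  exact: linking_simplex_compact_hausdorff.
rewrite link_boundaryE; move/continuous_closedP : link_depth_continuous; apply.
exact: closed_eq.
Qed.

End GeneratorSpaces.

Lemma compact_hausdorff_prod_gspace (G : finGroupType) (A B : gspace G) :
  compact_hausdorff A -> compact_hausdorff B -> compact_hausdorff (prod_gspace A B).
Proof.
by move=> cA cB; apply: compact_hausdorff_kify; exact: compact_hausdorff_prod.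
Qed.

(** The pushout-product map itself, injective with values in a Hausdorff space,
    separates the points of the pushout. *)
Lemma pp_gspace_compact_hausdorff (G : finGroupType) (A B K L : gspace G)
    (i : A -> B) (j : K -> L) (iI : isovariant i) (jI : isovariant j) :
  injective i -> injective j ->
  compact_hausdorff A -> compact_hausdorff B -> compact_hausdorff K ->
  compact_hausdorff L -> compact_hausdorff (pp_gspace iI jI).
Proof.
move=> i_inj j_inj cA cB cK cL; apply: compact_hausdorff_kify.
pose F (p : sum_space (prod_gspace A L) (prod_gspace B K)) : prod_gspace B L :=
  sum_map (pp_u (L := L) i) (pp_v (B := B) j) p.
have FE p : F p = @pushout_product _ _ _ _ _ _ _ iI jI (qpi _ p).
  by symmetry; exact: (@pushout_map_qpi _ _ _ _ _ _
    (pp_left_equivariant jI) (pp_top_equivariant iI)).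
apply: (@compact_hausdorff_quot _ (prod_gspace B L) _ unit (fun _ => F)).
- by apply: compact_sum_space; apply: (compact_hausdorff_prod_gspace _ _).1.
- exact: (compact_hausdorff_prod_gspace cB cL).2.
- move=> _; have [[ci _ _] [cj _ _]] := (iI, jI).
  apply/continuousP => O oO; split.
    move: O oO; apply/continuousP.
    apply: (@kify_continuous (A * L)%type (B * L)%type (pp_u i)).
    by apply: (@prod_map_continuous _ _ _ _ i id) => // x; exact: cvg_id.
  move: O oO; apply/continuousP.
  apply: (@kify_continuous (B * K)%type (B * L)%type (pp_v j)).
  by apply: (@prod_map_continuous _ _ _ _ id j) => // x; exact: cvg_id.
- by move=> _ x y xy; rewrite !FE; congr (pushout_product _); apply/qpi_eqP/rst_step.
- move=> x y /(_ tt); rewrite !FE => /pushout_product_inj xy.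
  by apply/qpi_eqP; exact: xy.
Qed.

Section PushoutProductImage.
Variables (G : finGroupType) (A B K L : gspace G) (i : A -> B) (j : K -> L).
Variables (iI : isovariant i) (jI : isovariant j).
Let pp := @pushout_product _ _ _ _ _ _ _ iI jI.

Lemma pushout_product_inl a l : exists x, pp x = (i a, l).
Proof.
exists (pushout_inl (pp_left_equivariant jI) (pp_top_equivariant iI) (a, l)).
exact: (@pushout_map_inl _ _ _ _ _ _ (pp_left_equivariant jI) (pp_top_equivariant iI)).
Qed.

Lemma pushout_product_inr b k : exists x, pp x = (b, j k).
Proof.
exists (pushout_inr (pp_left_equivariant jI) (pp_top_equivariant iI) (b, k)).
exact: (@pushout_map_inr _ _ _ _ _ _ (pp_left_equivariant jI) (pp_top_equivariant iI)).
Qed.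

Lemma pushout_product_image (P : prod_gspace B L -> Prop) :
  (forall a l, P (i a, l)) -> (forall b k, P (b, j k)) -> forall x, P (pp x).
Proof.
move=> Pl Pr; apply: pushout_ind => [[a l]|[b k]].
  rewrite /pp /pushout_product (pushout_map_inl _ _ (@pp_compat _ _ _ _ _ i j)).
  exact: Pl.
rewrite /pp /pushout_product (pushout_map_inr _ _ (@pp_compat _ _ _ _ _ i j)).
exact: Pr.
Qed.

End PushoutProductImage.

(** * Maps with exact isotropy off the boundary *)

Section Generator.
Variables (R : realType) (G : finGroupType) (U : grep R G) (c : level_coords U).

(** For each g outside of K take a vector on a single level that is fixed by K
    and not by g, and use a different level for each g. The starting level N is
    arbitrary, so these levels can avoid any finite set of levels. *)
Lemma exact_isotropy_vector (K : {group G}) N : exists w : U,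
  (forall n, (n < N)%N -> lc c n w = 0) /\
  forall g, grep_act g w = w <-> g \in K.
Proof.
have /choice [v vP] : forall g : G, exists v : {ffun lc_index c -> R^o},
    (forall h, h \in K -> lc_act h v = v) /\ (g \notin K -> lc_act g v != v).
  move=> g; have [gK|gK] := boolP (g \in K).
    by exists 0; split => // h _; rewrite lc_act0.
  by have [v [vK vg]] := lc_sep c gK; exists v.
pose x n := if (N <= n < N + size (enum G))%N then v (nth 1%g (enum G) (n - N)) else 0.
have [|w wx] := @lc_surj _ _ _ c x (N + size (enum G)).
  by move=> n nN; rewrite /x ltnNge nN andbF.
exists w; split => [n nN|g]; first by rewrite wx /x leqNgt nN.
split => [gw|gK].
  apply/negPn/negP => gK; have [_ /(_ gK) /eqP] := vP g; apply.
  have gE : g \in enum G by rewrite mem_enum.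
  have <- : lc c (N + index g (enum G)) w = v g.
    rewrite wx /x leq_addr /= ltn_add2l index_mem gE.
    by rewrite addKn nth_index.
  by rewrite -lcJ gw.
apply: (lc_inj (c := c)) => n; rewrite lcJ wx /x.
case: ifP => _; last by rewrite lc_act0.
have [vK _] := vP (nth 1%g (enum G) (n - N)); exact: vK.
Qed.

Variables (n : nat) (H : chain G n).
Local Notation LT := (link_total R G n).
Local Notation L := (linking_simplex R H).

Lemma rev_ord_max : rev_ord (ord_max : 'I_n.+1) = ord0.
Proof. by apply/val_inj; rewrite /= subnn. Qed.

(** The map [g, t] |-> (t_0 ... t_n) g w. It is well defined: the factor vanishes
    unless all t_i are nonzero, and then the class of (g, t) determines g H_0,
    hence g w. In that case the isotropy group of its value is g H_0 g^-1, which
    fixes [g, t]. *)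
Lemma linking_simplex_weighted_orbit_map (w : U) :
  (forall g, grep_act g w = w <-> g \in H ord0) ->
  exists f : L -> grep_gspace U,
   [/\ continuous f, equivariant f,
       forall l, exists g, f l = link_depth l *: grep_act g w :> U,
       forall l, link_boundary l -> f l = 0 :> U &
       forall l, link_boundary l \/ isotropy (f l) `<=` isotropy l].
Proof.
move=> wH.
pose F (p : LT) : colim_space U := bary_prod p *: (grep_act p.1 w : U) : U.
have rF p q : link_rel H p q -> F p = F q.
  move=> /link_rel_cosets [pq Hpq]; rewrite /F.
  have -> : bary_prod q = bary_prod p by rewrite /bary_prod /bary pq.
  have [->|nz] := eqVneq (bary_prod p) 0; first by rewrite !scale0r.
  congr (_ *: _); have := Hpq ord_max; rewrite rev_ord_max => /(_ _) Hm.
  have /Hm/lcoset_eqP : bary ord_max p != 0.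
    by apply: contra_neq nz => pm; apply/bary_prod_eq0; exists ord_max.
  rewrite mem_lcoset => /wH qp.
  by rewrite -[in RHS]qp -grep_actM mulKVg.
pose f (l : L) : grep_gspace U := F (repr (l : quot_space (@link_rel R G n H))).
have fE p : f (qpi _ p) = F p by exact: quot_liftE.
have qpiP (l : L) : exists p, l = qpi (@link_rel R G n H) p.
  by exists (repr (l : quot_space (@link_rel R G n H))); rewrite /qpi reprK.
exists f; split.
- apply: (@continuous_from_kify (quot_space (@link_rel R G n H)) (colim_space U)).
  apply: quot_lift_continuous => //.
  (* G is finite and discrete, so F is a combination of the vectors a w whose
     coefficients are continuous *)
  have -> : F = (fun p =>
      \sum_(a : G) (bary_prod p * (p.1 == a)%:R) *: grep_act a w).
    apply/funext => p; rewrite (bigD1 p.1) //= big1 ?addr0 ?eqxx ?mulr1 // => a ap.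
    by rewrite eq_sym (negbTE ap) mulr0 scale0r.
  apply: continuous_combination => a.
  have := @group_coord_continuous R G n (fun b => (b == a)%:R).
  exact: (continuousM_real (@bary_prod_continuous _ _ _)).
- move=> g l; have [p ->] := qpiP l.
  have -> : gact g (qpi (@link_rel R G n H) p : L) =
      (qpi (@link_rel R G n H) (gact g p) : L).
    exact: (quot_actE (@link_rel_inv R G n H)).
  by rewrite !fE /F /= grep_actM grep_actZ.
- by move=> l; exists (repr (l : quot_space (@link_rel R G n H))).1.
- by move=> l; rewrite link_boundaryE /f /F => l0; rewrite [bary_prod _]l0 scale0r.
- move=> l; have [l0|l0] := eqVneq (link_depth l) 0.
    by left; rewrite link_boundaryE.
  right => g; have [p lp] := qpiP l; rewrite lp link_depth_qpi in l0 *.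
  rewrite /isotropy /= fE /F grep_actZ.
  move=> /(congr1 (fun u : U => (bary_prod p)^-1 *: u)).
  rewrite !scalerA mulVf // !scale1r => gw.
  transitivity (qpi (@link_rel R G n H) (gact g p)).
    exact: (quot_actE (@link_rel_inv R G n H)).
  apply/qpi_eqP/rst_step; split => //=; exists ord_max; split.
  + apply: contra_neq l0 => pm; apply/bary_prod_eq0; exists ord_max.
    exact: pm.
  + by move=> j; rewrite ltnNge leq_ord.
  + rewrite !lcosetE rev_ord_max; apply/lcoset_eqP; rewrite mem_lcoset; apply/wH.
    by rewrite grep_actM grep_actM gw -grep_actM mulVg grep_act1.
Qed.

End Generator.

(** * The map from the universe to the terminal object is in I-inj *)

Section UniverseInjective.
Variables (R : realType) (G : finGroupType) (U : grep R G) (c : level_coords U).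

Lemma isovariant_extension_generator k n (H : chain G n)
    (u : gen_source R k H -> grep_gspace U) : isovariant u ->
  exists h : gen_target R k H -> grep_gspace U,
    isovariant h /\ forall x, h (gen_map x) = u x.
Proof.
move=> uI.
have cD := disc_gspace_compact_hausdorff R G k.
have cL := linking_simplex_compact_hausdorff R H.
have cA : compact_hausdorff (gen_source R k H).
  apply: pp_gspace_compact_hausdorff => //; try exact: sub_incl_inj.
    exact: sphere_gspace_compact_hausdorff.
  exact: boundary_simplex_compact_hausdorff.
have cB : compact_hausdorff (gen_target R k H).
  exact: compact_hausdorff_prod_gspace.
have inj : injective (@gen_map R G k n H).
  by apply: pushout_product_inj; exact: sub_incl_inj.
apply: (@isovariant_extension _ _ _ c _ _ (@gen_map R G k n H)) => //.
- exact: cA.1.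
- exact: gen_map_isovariant.
move=> N; have [w [wN wH]] := exact_isotropy_vector c (H ord0) N.
have [f [cf ef fw f0 fI]] := linking_simplex_weighted_orbit_map wH.
pose om (y : gen_target R k H) : grep_gspace U :=
  disc_defect y.1 *: (f y.2 : U) : U.
exists om; split.
- apply: (@continuousZ_colim _ _ _ c _ (fun y : gen_target R k H => disc_defect y.1)
    (fun y => f y.2) (@gspace_cg _ (gen_target R k H))).
    apply: (@continuous_from_kify
      (disc_gspace R G k * linking_simplex R H)%type R) => y.
    apply: (@continuous_comp _ _ _ fst (@disc_defect R G k)); first exact: cvg_fst.
    exact: disc_defect_continuous.
  apply: (@continuous_from_kify
    (disc_gspace R G k * linking_simplex R H)%type (colim_space U)) => y.
  exact: (@continuous_comp (disc_gspace R G k * linking_simplex R H)%type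
    (linking_simplex R H) (colim_space U) snd f y (@cvg_snd _ _ _ _ _) (cf y.2)).
- by move=> g y; rewrite /om /= ef /= grep_actZ.
- move=> y m mN; rewrite /om linearZ /=; have [g ->] := fw y.2.
  by rewrite linearZ /= lcJ wN // lc_act0 !scaler0.
- apply: (pushout_product_image (P := fun y => om y = 0 :> U)) => [s l|x b];
    rewrite /om /=.
    have sphere0 y : sphere y -> @disc_defect R G k y = 0 by rewrite sphereE.
    by rewrite sphere0 ?scale0r //; exact: set_valP.
  by rewrite f0 ?scaler0 //; exact: set_valP.
- move=> [x l]; have [x0|x0] := eqVneq (disc_defect x) 0.
    left; have xS : sphere x by rewrite sphereE.
    exact: (pushout_product_inl _ _ (SigSub (mem_set xS) : sphere_gspace R G k) l).
  have [lb|fl] := fI l.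
    left.
    exact: (pushout_product_inr _ _ x (SigSub (mem_set lb) : boundary_simplex R H)).
  right => g; rewrite /isotropy /om /= grep_actZ.
  move=> /(congr1 (fun u : U => (disc_defect x)^-1 *: u)).
  rewrite !scalerA mulVf // !scale1r => /fl.
  by rewrite /isotropy /prod_act /= => ->.
Qed.

Lemma universe_terminal_injective :
  inj_class (@I_gen R G) (tt : iso_hom (Some (grep_gspace U)) None).
Proof.
move=> A B i [k n H] [u uI] v _.
have [h [hI hu]] := isovariant_extension_generator uI.
exists (exist _ h hI); split; last by case: v.
by apply: eq_exist; apply/funext => x; exact: hu.
Qed.

End UniverseInjective.

(** Lifting the empty map to U against the map from U to the terminal object
    gives existence. *)
Theorem corollary5p6 (R : realType) (G : finGroupType) (U : grep R G)
    (X : gspace G) (hU : complete_universe U) (hX : I_cofibrant R X) :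
  (exists f : X -> grep_gspace U, isovariant f) /\
  (forall f0 f1 : X -> grep_gspace U,
     isovariant f0 -> isovariant f1 -> isovariant_homotopic R f0 f1).
Proof.
have [c] := complete_universe_level_coords hU; split; last first.
  by move=> f0 f1; exact: isovariant_maps_homotopic.
have [//|h _] := hX _ _ _ (universe_terminal_injective c)
  (empty_hom (grep_gspace U)) tt.
by exists (sval h); exact: svalP.
Qed.
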